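(* Let $q\ge3$ be an integer and let $W$ have the Pareto density $f_W(w)=(\tau-1)w^{-\tau}\mathbf{1}_{[1,\infty)}(w)$ with $\tau\ge4$. Then, for every $B\ge0$ with $\mathrm{e}^{-B}(q-1)>1$, the function $t\mapsto\frac{d^2}{dt^2}\mathscr{F}_B(t)$ is first positive and then negative. Consequently, there exists $\delta>0$ such that for all $0\le B\le\delta$ there is a first-order phase transition.
   Context: For $t\ge0$, $\mathscr{F}_B(t)=\mathbb{E}\Big[\frac{W}{\mathbb{E}[W]}\,\frac{\mathrm{e}^{tW+B}-1}{\mathrm{e}^{tW+B}+q-1}\Big]$. ''First positive and then negative'' means that there is a $t_*>0$ with $\frac{d^2}{dt^2}\mathscr{F}_B(t)>0$ for $0<t<t_*$ and $\frac{d^2}{dt^2}\mathscr{F}_B(t)<0$ for $t>t_*$. Phase transition: for $\beta>0$, $\beta'=\mathrm{e}^\beta-1$, let $s^\star(\beta,B)$ be the maximizer over $s\in[0,1]$ of $$p_{\beta,B}(s)=\mathbb{E}\big[\log(\mathrm{e}^{\beta'Ws+B}+q-1)\big]-\frac{\beta'\mathbb{E}[W]}{2q}\big[(q-1)s^2+2s-1\big].$$ There is a first-order phase transition (at field $B$) if there is a $\beta_c(B)\in(0,\infty)$ such that the maximizer $s^\star(\beta,B)$ is unique for all $\beta\ne\beta_c(B)$, and $\beta\mapsto s^\star(\beta,B)$ has a jump discontinuity at $\beta_c(B)$, i.e. $\lim_{\beta\nearrow\beta_c(B)}s^\star(\beta,B)<\lim_{\beta\searrow\beta_c(B)}s^\star(\beta,B)$.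 *)

(* Defs.v *)
From HB Require Import structures.
From mathcomp Require Export all_boot all_order all_algebra.
From mathcomp Require Export all_classical all_reals all_analysis.
Set Implicit Arguments.
Unset Strict Implicit.
Unset Printing Implicit Defensive.
Export Order.TTheory GRing.Theory Num.Theory.
Export numFieldNormedType.Exports.

Local Open Scope classical_set_scope.
Local Open Scope ring_scope.

Definition pareto_pdf (R : realType) (tau : R) : R -> R :=
  (fun w => (tau - 1) * w `^ (- tau)) \_ `[1, +oo[.

Definition has_density (d : measure_display) (T : measurableType d)
    (R : realType) (P : probability T R) (W : {RV P >-> R}) (f : R -> R) :=
  forall A : set R, measurable A ->
    distribution P W A = (\int[lebesgue_measure]_(w in A) (f w)%:E)%E.

Section Potts.
Context (d : measure_display) (T : measurableType d) (R : realType).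
Context (P : probability T R) (W : {RV P >-> R}) (q : nat).

(* [fine] sends infinite values to 0; for t, B, beta, s >= 0 all the expectations
   below are finite as soon as W is a.s. nonnegative and integrable and 1 <= q. *)
Definition meanW : R := fine 'E_P[W].

Definition FB (B t : R) : R :=
  fine 'E_P[fun x => (W x / meanW *
    ((expR (t * W x + B) - 1) / (expR (t * W x + B) + q%:R - 1)))%R].

Definition pressure (beta B s : R) : R :=
  let beta' := expR beta - 1 in
  fine 'E_P[fun x => ln (expR (beta' * W x * s + B) + q%:R - 1)%R]
  - beta' * meanW / (2 * q%:R) * ((q%:R - 1) * s ^+ 2 + 2 * s - 1).

Definition pressure_maximizers (beta B : R) : set R :=
  [set s | 0 <= s <= 1 /\
     forall u : R, 0 <= u <= 1 -> pressure beta B u <= pressure beta B s].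

(* Only meaningful when the maximizer exists and is unique. *)
Definition sstar (B beta : R) : R := xget 0 (pressure_maximizers beta B).

Definition first_order_transition (B : R) : Prop :=
  exists betac : R, 0 < betac /\
    (forall beta : R, 0 < beta -> beta != betac ->
       exists! s, pressure_maximizers beta B s) /\
    exists sl sr : R,
      sstar B beta @[beta --> betac^'-] --> sl /\
      sstar B beta @[beta --> betac^'+] --> sr /\
      sl < sr.

End Potts.

(* [derive1] is total, so twice differentiability has to be stated separately
   for [f^`(2)] to denote the second derivative. *)
Definition twice_derivable_pos (R : realType) (f : R -> R) : Prop :=
  forall t : R, 0 < t -> derivable f t 1 /\ derivable (f^`())%classic t 1.

Definition first_pos_then_neg (R : realType) (g : R -> R) : Prop :=
  exists tstar : R, 0 < tstar /\
    (forall t : R, 0 < t -> t < tstar -> 0 < g t) /\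
    (forall t : R, tstar < t -> g t < 0).

(* Main.v *)
(** Put a = tau - 2 >= 2 and g(x) = (e^(x+B) - 1) / (e^(x+B) + q - 1).  The
    substitution u = t w turns F = F_B into a t^a int_t^oo u^(-a-1) g(u) du, hence
    t F' = a (F - g), and then t F''' = (a - 2) F'' - a g''.  So t^(2-a) F'' has
    derivative - a t^(1-a) g'', whose sign changes exactly once, at the inflection
    point log(q-1) - B of g; moreover t^(2-a) F'' tends to 0 at +oo, and to +oo at 0
    because t^(1-a) >= 1/t there.  This gives the sign pattern of F''.

    For the phase transition, let b = e^beta - 1 and t = b s: up to an increasing
    affine change, the pressure is Phi(t) - t^2/(2b) with Phi' = F, whose critical
    points solve F(t)/t = 1/b.  The derivative of F(t)/t has the sign of t F' - F,
    which increases and then decreases, and is positive somewhere when B is small; so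
    F(t)/t decreases on (0, t1], increases on [t1, t2] and decreases on [t2, +oo).
    Hence maximizers lie in [0, t1] or [t2, +oo), at most one in each, and they are
    nondecreasing in b: they jump over (t1, t2) at a single value of b. *)
From HB Require Import structures.
Require Import Defs.
From mathcomp Require Import measurable_realfun ring lra.
Set Implicit Arguments.
Unset Strict Implicit.
Unset Printing Implicit Defensive.
Local Open Scope classical_set_scope.
Local Open Scope ring_scope.

(** * Expectations under the Pareto density *)

(** [f] and the Radon-Nikodym derivative of [nu] both integrate to [nu A] over every measurable [A],
    so they agree almost everywhere; finiteness of [nu] makes [f] integrable. *)
Lemma ge0_integral_density (d : measure_display) (T : measurableType d)
    (R : realType) (mu : {sigma_finite_measure set T -> \bar R})
    (nu : {finite_measure set T -> \bar R}) (f : T -> R) :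
  measurable_fun setT f -> (forall x, 0 <= f x) ->
  (forall A : set T, measurable A -> nu A = (\int[mu]_(x in A) (f x)%:E)%E) ->
  forall h : T -> \bar R, measurable_fun setT h -> (forall x, 0 <= h x)%E ->
  (\int[nu]_x h x = \int[mu]_x (h x * (f x)%:E))%E.
Proof.
move=> mf f0 nuE h mh h0;
have numu : nu `<< mu.
  apply/null_content_dominatesP => A mA muA0.
  rewrite nuE// null_set_integral//.
  exact/measurable_funTS/measurable_EFinP.
have fint : mu.-integrable setT (EFin \o f).
  apply/integrableP; split; first exact/measurable_EFinP.
  under eq_integral do rewrite /= ger0_norm//.
  by rewrite -nuE// ltey_eq fin_num_measure.
rewrite -(Radon_Nikodym_SigmaFinite.change_of_variables numu)//.
apply: ae_eq_integral => //.
- apply: emeasurable_funM => //.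
  exact: measurable_int (Radon_Nikodym_SigmaFinite.f_integrable numu).
- by apply: emeasurable_funM => //; exact/measurable_EFinP.
- apply: ae_eqe_mul2l; apply: integral_ae_eq => //.
  + exact: Radon_Nikodym_SigmaFinite.f_integrable.
  + exact/measurable_EFinP.
  + by move=> A _ mA; rewrite -Radon_Nikodym_SigmaFinite.f_integral// nuE.
Qed.

Section pareto.
Context (d : measure_display) (T : measurableType d) (R : realType).
Context (P : probability T R) (W : {RV P >-> R}) (tau : R).
Hypotheses (tau1 : 1 <= tau) (hW : has_density W (pareto_pdf tau)).

Let pdf_ge0 x : 0 <= pareto_pdf tau x.
Proof.
rewrite /pareto_pdf patchE; case: ifPn => // _.
by rewrite mulr_ge0 ?powR_ge0 ?subr_ge0.
Qed.

Let measurable_pdf : measurable_fun setT (pareto_pdf tau).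
Proof.
rewrite /pareto_pdf; apply/(measurable_restrictT _ _).1 => //.
by apply: measurable_funM => //; apply: measurable_funTS; exact: measurable_powR.
Qed.

Lemma pareto_ge1 : {ae P, forall x, 1 <= W x}.
Proof.
exists (W @^-1` `]-oo, 1[); split.
- by apply: measurable_funPTI; exact: measurable_itv.
- have := hW (measurable_itv `]-oo, 1[); rewrite /distribution/= /pushforward => ->.
  rewrite integral0_eq// => x /=; rewrite in_itv/= => x1.
  by rewrite /pareto_pdf patchE memNset//= in_itv/= andbT leNgt x1.
- by move=> x /=; rewrite in_itv/= => /negP; rewrite -ltNge.
Qed.

Lemma expectation_pareto (phi : R -> R) :
  measurable_fun setT phi -> (forall w, 1 <= w -> 0 <= phi w) ->
  ('E_P[phi \o W] =
  \int[lebesgue_measure]_(w in `[1%R, +oo[)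
     (phi w * ((tau - 1) * w `^ (- tau)))%:E)%E.
Proof.
(* [phi] is controlled only where the density lives, so it is cut off to [[1, +oo[]: almost surely
   nothing changes, and [psi] is nonnegative everywhere. *)
move=> mphi phi0; pose psi := phi \_ `[1, +oo[.
have mpsi : measurable_fun setT psi.
  by apply/(measurable_restrictT _ _).1 => //; exact: measurable_funTS.
have psi0 x : 0 <= psi x.
  by rewrite /psi patchE; case: ifPn => //; rewrite inE/= in_itv/= andbT => /phi0.
rewrite unlock; transitivity (\int[P]_x ((EFin \o psi) \o W) x)%E.
  apply: ae_eq_integral => //.
  - by apply/measurable_EFinP; exact: measurableT_comp.
  - by apply: measurableT_comp => //; exact/measurable_EFinP.
  - apply: filterS pareto_ge1 => x W1 _ /=.
    by rewrite /psi patchE mem_set//= in_itv/= andbT.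
have mE : measurable_fun setT (EFin \o psi) by exact/measurable_EFinP.
have E0 x : (0 <= (EFin \o psi) x)%E by rewrite lee_fin.
(* [W] takes values in [R] with its default display, while the Lebesgue measure
   lives on [measurableTypeR R], which has the same measurable sets. *)
have mW : measurable_fun setT (W : T -> measurableTypeR R) by exact: measurable_funPT W.
pose W' : {RV P >-> measurableTypeR R} := HB.pack (W : T -> measurableTypeR R)
  (isMeasurableFun.Build _ _ _ _ _ mW).
rewrite -[LHS](@ge0_integral_distribution _ _ _ (measurableTypeR R) _ _ W')//.
rewrite (ge0_integral_density measurable_pdf pdf_ge0 (mu:=lebesgue_measure))//.
rewrite [RHS]integral_mkcond; apply: eq_integral => x _ /=.
rewrite /psi /pareto_pdf !patchE; case: ifPn => // _.
by rewrite mul0e.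
Qed.

End pareto.

(** * Power tails *)

Section power_tails.
Context (R : realType).
Notation mu := (@lebesgue_measure R).

Lemma continuous_powR (b x : R) : 0 < x -> {for x, continuous (fun u => u `^ b)}.
Proof.
move=> x0; apply: differentiable_continuous; apply/derivable1_diffP.
by apply: derivable_powR; rewrite in_itv/= x0.
Qed.

Lemma within_continuous_itvcy (f : R -> R) (t : R) :
  (forall x, t <= x -> {for x, continuous f}) -> {within `[t, +oo[, continuous f}.
Proof.
move=> cf; apply: continuous_in_subspaceT => x.
by rewrite inE/= in_itv/= andbT => /cf.
Qed.

Lemma powRN_cvgy (c : R) : 0 < c -> u `^ (- c) @[u --> +oo] --> (0 : R).
Proof.
move=> c0; have H : expR (- (c * ln u)) @[u --> +oo] --> (0 : R).
  apply: (cvg_comp (fun u => c * ln u) (fun v => expR (- v))) (@cvgr_expR R).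
  apply/cvgryPgt => A; near=> u.
  rewrite -ltr_pdivrMl// -ltr_expR lnK; last by rewrite posrE; near: u; exact: nbhs_pinfty_gt.
  by near: u; exact: nbhs_pinfty_gt.
apply: cvg_trans H; apply: near_eq_cvg; near=> u.
have u0 : 0 < u by near: u; exact: nbhs_pinfty_gt.
by rewrite /powR gt_eqF ?mulNr.
Unshelve. all: by end_near. Qed.

Lemma integral_powRN_itvy (c t : R) : 0 < c -> 0 < t ->
  (\int[mu]_(u in `[t, +oo[) (u `^ (- c - 1))%:E = (t `^ (- c) / c)%:E)%E.
Proof.
move=> c0 t0; pose F (u : R) : R := - c^-1 * u `^ (- c).
have dF (u : R) : 0 < u -> is_derive u 1 F (u `^ (- c - 1)).
  move=> u0; have H := is_derive1_powR (- c) u0.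
  apply: (@is_derive_eq _ _ _ _ _ _ _ _ (is_deriveM (is_derive_cst (- c^-1) u 1) H)).
  by rewrite scaler0 addr0 /GRing.scale/= mulrA mulrNN mulVf ?mul1r// gt_eqF.
rewrite (@ge0_continuous_FTC2y _ _ F t 0); last first.
- move=> x; rewrite in_itv/= andbT => tx.
  have [_] := dF x (lt_trans t0 tx).
  by rewrite derive1E.
- have [+ _] := dF t t0 => /derivable1_diffP/differentiable_continuous.
  by apply: cvg_within_filter.
- by move=> x tx; have [] := dF x (lt_trans t0 tx).
- rewrite -(mulr0 (- c^-1)); apply: cvgMr; exact: powRN_cvgy.
- apply: within_continuous_itvcy => x tx; apply: continuous_powR.
  exact: lt_le_trans tx.
- by move=> x _; exact: powR_ge0.
by rewrite /F -EFinB sub0r mulNr opprK mulrC.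
Qed.

Lemma integrable_powRN_itvy (c t : R) : 0 < c -> 0 < t ->
  mu.-integrable `[t, +oo[ (EFin \o (fun u => u `^ (- c - 1))).
Proof.
move=> c0 t0; apply/integrableP; split.
  by apply/measurable_EFinP/measurable_funTS; exact: measurable_powR.
under eq_integral do rewrite /= ger0_norm ?powR_ge0//.
by rewrite integral_powRN_itvy// ltry.
Qed.

End power_tails.

Section scaled_integral.
Context (R : realType) (a : R) (h : R -> R).
Hypotheses (a0 : 0 < a) (ch : continuous h).
Hypothesis h01 : forall x : R, 0 <= x -> 0 <= h x <= 1.
Notation mu := (@lebesgue_measure R).

Let kernel (u : R) : R := u `^ (- a - 1) * h u.

(** When [h] is the Potts ratio, a t^a [power_tail] t is F_B(t) for t > 0. In this form t enters the
    integral only through its lower limit. *)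
Definition power_tail (t : R) : R := Rintegral mu `[t, +oo[ kernel.

Let measurable_kernel (D : set R) : measurable D -> measurable_fun D kernel.
Proof.
move=> mD; apply: measurable_funTS; apply: measurable_funM.
  exact: measurable_powR.
exact: continuous_measurable_fun.
Qed.

Lemma integrable_power_kernel (t : R) : 0 < t ->
  mu.-integrable `[t, +oo[ (EFin \o kernel).
Proof.
move=> t0; apply: le_integrable (integrable_powRN_itvy a0 t0) => //.
  by apply/measurable_EFinP; exact: measurable_kernel.
move=> x /=; rewrite in_itv/= andbT => tx.
have /andP[h0 h1] := h01 (ltW (lt_le_trans t0 tx)).
by rewrite lee_fin !ger0_norm ?mulr_ge0 ?powR_ge0// ler_piMr ?powR_ge0.
Qed.

Let continuous_kernel (x : R) : 0 < x -> {for x, continuous kernel}.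
Proof. by move=> x0; apply: cvgM; [exact: continuous_powR|exact: ch]. Qed.

(** Near t the tail is its value at s = t/2 minus the integral over [s, x], to which the fundamental
    theorem of calculus applies. The base point s is positive so that the kernel is integrable from
    s on. *)
Lemma is_derive_power_tail (t : R) : 0 < t ->
  is_derive t 1 power_tail (- (t `^ (- a - 1) * h t)).
Proof.
move=> t0; pose s := t / 2.
have s0 : 0 < s by rewrite divr_gt0.
have st : s < t by rewrite /s; lra.
have ks : mu.-integrable `[s, t + 1] (EFin \o kernel).
  by apply: integrableS (integrable_power_kernel s0) => //; exact: subset_itvl.
have t1 : t < t + 1 by rewrite ltrDl.
have [dF F'] := @continuous_FTC1_closed _ kernel s t (t + 1) t1 ks st (continuous_kernel t0).
pose F x := power_tail s - Rintegral mu `[s, x] kernel.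
apply: (@near_eq_is_derive _ _ _ F).
  near=> x; have sx : s < x by near: x; exact: lt_nbhsr.
  rewrite /F /power_tail Rintegral_itvB//; [|exact: integrable_power_kernel|by rewrite bnd_simp ltW].
  rewrite Rintegral_itv_obnd_cbnd//.
  apply: integrableS (integrable_power_kernel (lt_trans s0 sx)) => //.
  by apply: subset_itvr; rewrite bnd_simp.
have dI : is_derive t 1 (fun x => Rintegral mu `[s, x] kernel) (kernel t).
  by apply: DeriveDef; [exact: dF|rewrite -derive1E; exact: F'].
apply: is_derive_eq (is_deriveB (is_derive_cst (power_tail s) t 1) dI) _.
exact: sub0r.
Unshelve. all: by end_near. Qed.

(** Substitution u = t w. The extra factor w of the size-biased mean turns the Pareto exponent
    -(a+2) into -a-1, and t^a compensates the powers of t produced by u^(-a-1) du. *)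
Lemma power_tail_scale (t : R) : 0 < t ->
  (\int[mu]_(w in `[1%R, +oo[) (w * h (t * w) * w `^ (- (a + 2)))%:E =
   (t `^ a * power_tail t)%:E)%E.
Proof.
move=> t0; rewrite EFinM /power_tail fineK; last first.
  exact: integrable_fin_num (integrable_power_kernel t0).
rewrite -ge0_integralZl//; last 3 first.
- by apply/measurable_EFinP; exact: measurable_kernel.
- move=> x /=; rewrite in_itv/= andbT => tx; rewrite lee_fin mulr_ge0 ?powR_ge0//.
  by have /andP[] := h01 (ltW (lt_le_trans t0 tx)).
- by rewrite lee_fin powR_ge0.
pose F w := t * w; pose G u := t `^ a * kernel u.
have F1 : F^`()%classic = cst t.
  apply/funext => x; rewrite derive1E.
  have H := is_deriveM (is_derive_cst t x 1) (is_derive_id x 1).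
  rewrite -[F]/(cst t * id) (@derive_val _ _ _ _ _ _ _ H).
  by rewrite scaler0 addr0 /GRing.scale/= mulr1.
transitivity (\int[mu]_(u in `[F 1%R, +oo[) (G u)%:E)%E; last first.
  by rewrite /F mulr1; apply: eq_integral => u _; rewrite EFinM.
have cF : continuous F by move=> x; apply: cvgM; [exact: cvg_cst|exact: cvg_id].
rewrite increasing_ge0_integration_by_substitutiony//; first last.
- move=> x; rewrite in_itv/= andbT /F mulr1 => tx; rewrite mulr_ge0 ?powR_ge0//.
  by rewrite mulr_ge0 ?powR_ge0//; have /andP[] := h01 (ltW (lt_trans t0 tx)).
- apply: within_continuous_itvcy => x; rewrite /F mulr1 => tx.
  apply: cvgM; first exact: cvg_cst.
  by apply: continuous_kernel; exact: lt_le_trans tx.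
- by rewrite /F; apply: gt0_cvgMry.
- split; last by apply: cvg_at_right_filter; exact: cF.
  by move=> x _; exact: derivableM.
- by rewrite F1; apply: is_cvg_cst.
- by rewrite F1; apply: is_cvg_cst.
- by rewrite F1 => x _; exact: cst_continuous.
- by move=> x y _ _ xy; rewrite /F ltr_pM2l.
apply: eq_integral => w; rewrite inE/= in_itv/= andbT => w1.
have w0 : 0 < w by exact: lt_le_trans w1.
rewrite F1 /= /G /F /kernel; congr EFin.
rewrite [RHS]/GRing.mul/=.
rewrite powRM ?ltW//.
have -> : w `^ (- (a + 2)) = w `^ (- a - 1) * w^-1.
  by rewrite -powR_inv1 ?ltW// -powRD ?(gt_eqF w0) ?implybT//; congr (_ `^ _); lra.
have -> : t `^ (- a - 1) = (t `^ a)^-1 * t^-1.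
  by rewrite -powRN -powR_inv1 ?ltW// -powRD// (gt_eqF t0) implybT.
field.
by rewrite !gt_eqF ?powR_gt0.
Qed.

(** Product rule, with t^a t^(-a-1) = 1/t in the boundary term. The derivative is again expressed
    through the function itself, which is the source of the differential equation for F. *)
Lemma is_derive_scaled (t : R) : 0 < t ->
  is_derive t 1 (fun t => t `^ a * power_tail t)
    ((a * (t `^ a * power_tail t) - h t) / t).
Proof.
move=> t0; apply: (@is_derive_eq _ _ _ _ _ _ _ _
  (is_deriveM (is_derive1_powR a t0) (is_derive_power_tail t0))).
rewrite /GRing.scale/=.
have -> : t `^ (a - 1) = t `^ a * t^-1.
  by rewrite -powR_inv1 ?ltW// -powRD// (gt_eqF t0) implybT.
have -> : t `^ (- a - 1) = (t `^ a)^-1 * t^-1.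
  by rewrite -powRN -powR_inv1 ?ltW// -powRD// (gt_eqF t0) implybT.
field.
by rewrite !gt_eqF ?powR_gt0.
Qed.

Lemma power_tail_ge0 (t : R) : 0 < t -> 0 <= power_tail t.
Proof.
move=> t0; apply: Rintegral_ge0 => u /=; rewrite in_itv/= andbT => tu.
by have /andP[h0 _] := h01 (ltW (lt_le_trans t0 tu)); rewrite mulr_ge0 ?powR_ge0.
Qed.

Lemma power_tail_le (t : R) : 0 < t -> t `^ a * power_tail t <= a^-1.
Proof.
move=> t0; rewrite -ler_pdivlMl ?powR_gt0// -powRN.
have -> : t `^ (- a) * a^-1 = Rintegral mu `[t, +oo[ (fun u => u `^ (- a - 1)).
  by rewrite /Rintegral integral_powRN_itvy.
apply: le_Rintegral => //; [exact: integrable_power_kernel|exact: integrable_powRN_itvy|].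
move=> u /=; rewrite in_itv/= andbT => tu.
have /andP[h0 h1] := h01 (ltW (lt_le_trans t0 tu)).
by rewrite ler_piMr ?powR_ge0.
Qed.

End scaled_integral.

Lemma le_power_tail (R : realType) (a t : R) (h h' : R -> R) :
  0 < a -> 0 < t -> continuous h -> continuous h' ->
  (forall x, 0 <= x -> 0 <= h x <= 1) -> (forall x, 0 <= x -> 0 <= h' x <= 1) ->
  (forall x, 0 <= x -> h x <= h' x) -> power_tail a h t <= power_tail a h' t.
Proof.
move=> a0 t0 ch ch' h01 h'01 hh'; apply: le_Rintegral => //.
- exact: integrable_power_kernel.
- exact: integrable_power_kernel.
- move=> u /=; rewrite in_itv/= andbT => tu.
  by rewrite ler_wpM2l ?powR_ge0// hh'// ltW// (lt_le_trans t0).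
Qed.

(** * The equation t F' = a (F - g) *)

Section derivative_sign.
Context (R : realType).
Implicit Types f df : R -> R.

Lemma is_derive_continuous f (x d : R) : is_derive x 1 f d -> {for x, continuous f}.
Proof.
by move=> [df _]; apply: differentiable_continuous; apply/derivable1_diffP.
Qed.

Lemma is_derive_within_continuous f df (x y : R) :
  (forall z, x <= z <= y -> is_derive z 1 f (df z)) ->
  {within `[x, y], continuous f}.
Proof.
move=> h; apply: continuous_in_subspaceT => z.
by rewrite inE/= in_itv/= => /h; exact: is_derive_continuous.
Qed.

Lemma is_derive_gt0_lt f df (x y : R) : x < y ->
  {within `[x, y], continuous f} ->
  (forall z, x < z < y -> is_derive z 1 f (df z)) ->
  (forall z, x < z < y -> 0 < df z) -> f x < f y.
Proof.
move=> xy cf h df0; have [c] := MVT xy (fun z (zxy : z \in `]x, y[) => h z zxy) cf.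
rewrite in_itv/= => cxy fE; rewrite -subr_gt0 fE.
by rewrite mulr_gt0 ?subr_gt0// df0.
Qed.

Lemma is_derive_lt0_gt f df (x y : R) : x < y ->
  {within `[x, y], continuous f} ->
  (forall z, x < z < y -> is_derive z 1 f (df z)) ->
  (forall z, x < z < y -> df z < 0) -> f y < f x.
Proof.
move=> xy cf h df0; have [c] := MVT xy (fun z (zxy : z \in `]x, y[) => h z zxy) cf.
rewrite in_itv/= => cxy fE; rewrite -subr_lt0 fE.
by rewrite pmulr_llt0 ?subr_gt0// df0.
Qed.

Lemma is_derive_local_max f (t d : R) : 0 < t -> is_derive t 1 f d ->
  (forall x : R, 0 < x -> derivable f x 1) ->
  (forall x : R, 0 < x -> f x <= f t) -> d = 0.
Proof.
move=> t0 ft df fmax.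
have tt : 0 <= t + 1 by lra.
have [||| _ f0] := @derive1_at_max R f 0 (t + 1) t tt.
- by move=> x; rewrite in_itv/= => /andP[x0 _]; exact: df.
- by rewrite in_itv/= t0 ltrDl ltr01.
- by move=> x; rewrite in_itv/= => /andP[x0 _]; exact: fmax.
by have [_ <-] := ft.
Qed.

End derivative_sign.

(** * Sign of F'' and monotonicity of F(t)/t for bounded solutions *)

Section averaging_ode.
Context (R : realType) (a u0 m s C : R) (F g g1 g2 : R -> R).
Hypotheses (a2 : 2 <= a) (u0_gt0 : 0 < u0) (m0 : 0 < m) (s0 : 0 < s).
Hypothesis F_ode : forall t : R, 0 < t -> is_derive t 1 F (a * (F t - g t) / t).
Hypothesis dg : forall t : R, is_derive t 1 g (g1 t).
Hypothesis dg1 : forall t : R, is_derive t 1 g1 (g2 t).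
Hypothesis F01 : forall t : R, 0 < t -> 0 <= F t <= 1.
Hypothesis g01 : forall t : R, 0 < t -> 0 < g t < 1.
Hypothesis g1C : forall t : R, 0 < t -> `|g1 t| <= C.
Hypothesis g2m : forall t : R, 0 < t < s -> m <= g2 t.
Hypothesis g2_gt0 : forall t : R, 0 < t < u0 -> 0 < g2 t.
Hypothesis g2_lt0 : forall t : R, u0 < t -> g2 t < 0.
Hypothesis g_cvg1 : g x @[x --> +oo] --> (1 : R).

Let a_gt0 : 0 < a.
Proof. exact: lt_le_trans a2. Qed.

(** [F1] and [F2] are F' and F'' as read off from the equation: differentiating t F' = a (F - g)
    gives t F'' = (a - 1) F' - a g'. Smoothness of F is thus inherited from g. *)
Let F1 t := a * (F t - g t) / t.
Let F2 t := ((a - 1) * F1 t - a * g1 t) / t.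

Let is_derive_F1 (t : R) : 0 < t -> is_derive t 1 F1 (F2 t).
Proof.
move=> t0; have tn0 : t != 0 by rewrite gt_eqF.
have H := is_deriveM (is_deriveM (is_derive_cst a t 1) (is_deriveB (F_ode t0) (dg t)))
  (is_deriveV tn0 (is_derive_id t 1)).
apply: (@is_derive_eq _ _ _ _ _ _ _ _ H).
by rewrite /GRing.scale/= /F2 /F1 !fctE; field.
Qed.

Let is_derive_F2 (t : R) : 0 < t ->
  is_derive t 1 F2 (((a - 2) * F2 t - a * g2 t) / t).
Proof.
move=> t0; have tn0 : t != 0 by rewrite gt_eqF.
have H := is_deriveM (is_deriveB (is_deriveM (is_derive_cst (a - 1) t 1) (is_derive_F1 t0))
   (is_deriveM (is_derive_cst a t 1) (dg1 t)))
  (is_deriveV tn0 (is_derive_id t 1)).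
apply: (@is_derive_eq _ _ _ _ _ _ _ _ H).
by rewrite /GRing.scale/= /F2 !fctE; field.
Qed.

(* The integrating factor t^(2-a) turns the equation t F''' = (a - 2) F'' - a g''
   into H' = - a t^(1-a) g''. *)
Let H t := t `^ (2 - a) * F2 t.
Let H1 t := - (a * t `^ (1 - a) * g2 t).

Let is_derive_H (t : R) : 0 < t -> is_derive t 1 H (H1 t).
Proof.
move=> t0; have tn0 : t != 0 by rewrite gt_eqF.
apply: (@is_derive_eq _ _ _ _ _ _ _ _
  (is_deriveM (is_derive1_powR (2 - a) t0) (is_derive_F2 t0))).
have -> : t `^ (2 - a) = t `^ (1 - a) * t.
  rewrite -[X in _ = _ * X]powRr1 ?ltW// -powRD ?tn0 ?implybT//.
  by congr (_ `^ _); lra.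
have -> : t `^ (2 - a - 1) = t `^ (1 - a) by congr (_ `^ _); lra.
by rewrite /GRing.scale/= /H1; field.
Qed.

Let H_within (x y : R) : 0 < x -> {within `[x, y], continuous H}.
Proof.
move=> x0; apply: (@is_derive_within_continuous _ _ H1) => z /andP[xz _].
by apply: is_derive_H; exact: lt_le_trans xz.
Qed.

Let H1_lt0 (t : R) : 0 < t < u0 -> H1 t < 0.
Proof.
move=> /andP[t0 tu]; rewrite oppr_lt0 mulr_gt0 ?g2_gt0 ?t0//.
by rewrite mulr_gt0 ?powR_gt0.
Qed.

Let H_decr (x y : R) : 0 < x -> x < y -> y <= u0 -> H y < H x.
Proof.
move=> x0 xy yu; apply: (@is_derive_lt0_gt _ H H1 _ _ xy); first exact: H_within.
  by move=> z /andP[xz zy]; apply: is_derive_H; exact: lt_trans xz.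
move=> z /andP[xz zy]; apply: H1_lt0.
by rewrite (lt_trans x0 xz) (lt_le_trans zy yu).
Qed.

Let H_incr (x y : R) : u0 <= x -> x < y -> H x < H y.
Proof.
move=> ux xy; have x0 := lt_le_trans u0_gt0 ux.
apply: (@is_derive_gt0_lt _ H H1 _ _ xy); first exact: H_within.
  by move=> z /andP[xz zy]; apply: is_derive_H; exact: lt_trans xz.
move=> z /andP[xz zy]; rewrite oppr_gt0 pmulr_rlt0 ?g2_lt0//.
  exact: le_lt_trans xz.
by rewrite mulr_gt0 ?powR_gt0//; exact: lt_trans xz.
Qed.

Let C_ge0 : 0 <= C.
Proof. by apply: le_trans (g1C s0); exact: normr_ge0. Qed.

(** For t >= 1, the bounds on F and g give F' <= a, while t^(2-a) <= 1 because a >= 2. An upper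
    bound tending to 0 is all that [H_lt0] asks for. *)
Let H_le (t : R) : 1 <= t -> H t <= (a * a + a * C) / t.
Proof.
move=> t1; have t0 : 0 < t by exact: lt_le_trans t1.
have aa := ltW a_gt0; have a2' := a2.
apply: (@le_trans _ _ (t `^ (2 - a) * ((a * a + a * C) / t))).
  rewrite ler_wpM2l ?powR_ge0// /F2 ler_pM2r ?invr_gt0//.
  have F1a : F1 t <= a.
    rewrite /F1 ler_pdivrMr//.
    have /andP[_ F1'] := F01 t0; have /andP[g0 _] := g01 t0.
    by rewrite ler_wpM2l//; lra.
  have g1t := g1C t0; rewrite ler_norml in g1t; case/andP: g1t => g1l _.
  apply: lerD.
    by apply: (@le_trans _ _ ((a - 1) * a)); [rewrite ler_wpM2l//; lra | nra].
  by rewrite -mulrN ler_wpM2l//; lra.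
rewrite ler_piMl//; last by rewrite -[leRHS](powRr0 t) ler_powR//; lra.
by rewrite divr_ge0 ?(ltW t0)// addr_ge0 ?mulr_ge0 ?C_ge0.
Qed.

(** Past [u0] the function [H] increases strictly, yet it lies below K/t, which tends to 0; a
    strictly increasing function with this property stays negative. *)
Let H_lt0 (t : R) : u0 <= t -> H t < 0.
Proof.
move=> ut; set K := a * a + a * C.
have K0 : 0 < K by rewrite ltr_wpDr ?mulr_ge0 ?C_ge0 ?mulr_gt0 ?ltW.
have t1 : t < t + 1 by rewrite ltrDl.
apply: (lt_le_trans (H_incr ut t1)); rewrite leNgt; apply/negP => Hpos.
(* This point lies beyond t + 1 and satisfies K/x <= H(t + 1), so that H(t + 1) < H(x) <= K/x is
   contradictory. *)
pose x := Num.max (t + 2) (Num.max 1 (K / H (t + 1))).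
have xt : t + 1 < x by rewrite /x lt_max; apply/orP; left; lra.
have x1 : 1 <= x by rewrite /x !le_max lexx orbT.
have xK : K / H (t + 1) <= x by rewrite /x !le_max lexx !orbT.
have := lt_le_trans (H_incr (le_trans ut (ltW t1)) xt) (H_le x1).
rewrite ltr_pdivlMr; last exact: lt_le_trans x1.
by rewrite mulrC ltNge -ler_pdivrMr// xK.
Qed.

(* Since t^(1-a) >= 1/t near 0, H grows at least like -log t as t -> 0. *)
Let H_pos_near0 : exists2 t, 0 < t < u0 & 0 < H t.
Proof.
(* Below [r] the bound g'' >= m holds, and so does t^(1-a) >= 1/t, which uses both t <= 1 and a >=
   2. *)
pose r := Num.min 1 (Num.min s u0).
have r0 : 0 < r by rewrite !lt_min ltr01 s0.
have am : 0 < a * m by rewrite mulr_gt0.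
(* Adding a m log t makes the logarithmic growth of [H] explicit: [K] is nonincreasing on (0, r). *)
pose K t := H t + a * m * ln t.
have dK (t : R) : 0 < t -> is_derive t 1 K (H1 t + a * m * t^-1).
  move=> t0; apply: (@is_derive_eq _ _ _ _ _ _ _ _
    (is_deriveD (is_derive_H t0) (is_deriveM (is_derive_cst (a * m) t 1) (is_derive1_ln t0)))).
  by rewrite scaler0 addr0.
have K_le (t : R) : 0 < t -> t < r -> K r <= K t.
  move=> t0 tr; have [z||c] := @MVT R K (fun t => H1 t + a * m * t^-1) t r tr.
  - by rewrite in_itv/= => /andP[tz _]; apply: dK; exact: lt_trans tz.
  - apply: (@is_derive_within_continuous _ _ (fun t => H1 t + a * m * t^-1)) => z /andP[tz _].
    by apply: dK; exact: lt_le_trans tz.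
  rewrite in_itv/= => /andP[tc cr] KE; rewrite -subr_le0 KE.
  have c0 := lt_trans t0 tc.
  rewrite mulr_le0_ge0 ?subr_ge0 ?(ltW tr)// addrC subr_le0 /H1.
  rewrite -!mulrA ler_wpM2l ?(ltW a_gt0)//.
  move: cr; rewrite !lt_min => /and3P[c1 cs cu].
  rewrite mulrC; apply: ler_pM; first by rewrite invr_ge0 ltW.
  - exact: ltW.
  - rewrite -powR_inv1; last exact: ltW.
    apply: ger_powR; first by rewrite c0 ltW.
    by have := a2; lra.
  - by apply: g2m; rewrite c0.
(* The exponential forces a m log t < K(r), hence H(t) >= K(r) - a m log t > 0; the -1 in it makes
   the inequality strict. *)
pose t := Num.min (r / 2) (expR (K r / (a * m) - 1)).
have t0 : 0 < t by rewrite lt_min divr_gt0//= expR_gt0.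
have tr : t < r by rewrite gt_min; apply/orP; left; lra.
have tu : t < u0 by apply: lt_le_trans tr _; rewrite !ge_min lexx !orbT.
exists t; first by rewrite t0.
have lnt : ln t < K r / (a * m).
  apply: (@le_lt_trans _ _ (K r / (a * m) - 1)); last by lra.
  by rewrite -[leRHS]expRK ler_ln ?posrE ?expR_gt0// ge_min lexx orbT.
have := K_le _ t0 tr; rewrite {2}/K -lerBlDr; apply: lt_le_trans.
by rewrite subr_gt0 mulrC -ltr_pdivlMr.
Qed.

(** [H] falls strictly on (0, u0] from a positive to a negative value and is negative from [u0] on,
    so it changes sign once; the positive factor t^(2-a) passes this on to [F2]. *)
Let F2_sign : exists t_star : R, [/\ 0 < t_star,
  forall t, 0 < t -> t < t_star -> 0 < F2 t & forall t, t_star < t -> F2 t < 0].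
Proof.
have [t1 /andP[t10 t1u] Ht1] := H_pos_near0.
have Hu := H_lt0 (lexx u0).
have cH : {within `[t1, u0], continuous H} by exact: H_within.
have [|ts] := @IVT R H t1 u0 0 (ltW t1u) cH.
  by rewrite ge_min le_max (ltW Ht1) (ltW Hu) orbT.
rewrite in_itv/= => /andP[t1ts tsu] Hts.
have ts0 := lt_le_trans t10 t1ts.
have HF2 (t : R) : 0 < t -> (0 < H t) = (0 < F2 t).
  by move=> t0; rewrite pmulr_rgt0 ?powR_gt0.
have HF2' (t : R) : 0 < t -> (H t < 0) = (F2 t < 0).
  by move=> t0; rewrite pmulr_rlt0 ?powR_gt0.
exists ts; split => // t.
  by move=> t0 tts; rewrite -HF2// -Hts H_decr.
move=> tst; rewrite -HF2' ?(lt_trans ts0)//.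
have [tu|/ltW] := leP t u0; last exact: H_lt0.
by rewrite -Hts H_decr.
Qed.

Let derivable_F : twice_derivable_pos F /\
  forall t : R, 0 < t -> (F^`(2))%classic t = F2 t.
Proof.
(* The equation holds only for t > 0, so F' and [F1] are compared on a neighbourhood, which suffices
   to differentiate once more. *)
have FF1 (t : R) : 0 < t -> \forall x \near t, F1 x = (F^`())%classic x.
  move=> t0; near=> x; have x0 : 0 < x by near: x; exact: lt_nbhsr.
  by have [_ FE] := F_ode x0; rewrite derive1E FE.
split=> [t t0|t t0].
  have [dF _] := F_ode t0; split; first exact: dF.
  by have [] := near_eq_is_derive (FF1 t t0) (is_derive_F1 t0).
by have [_ <-] := near_eq_is_derive (FF1 t t0) (is_derive_F1 t0); rewrite derive1nS derive1E.
Unshelve. all: by end_near. Qed.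

Lemma ode_first_pos_then_neg :
  twice_derivable_pos F /\ first_pos_then_neg ((F^`(2))%classic).
Proof.
have [dF F2E] := derivable_F; have [ts [ts0 F2p F2n]] := F2_sign.
split => //; exists ts; split => //; split => t tt.
  by move=> ?; rewrite F2E// F2p.
by rewrite F2E ?F2n// (lt_trans ts0).
Qed.

(** If F(t) = 1, then t is a maximum on (0, +oo) and F'(t) = 0; the equation forces F(t) = g(t),
    which is less than 1. *)
Lemma ode_lt1 (t : R) : 0 < t -> F t < 1.
Proof.
move=> t0; have /andP[_ Ft1] := F01 t0; rewrite lt_neqAle Ft1 andbT.
apply/negP => /eqP Ft.
have dF (x : R) : 0 < x -> derivable F x 1 by move=> /F_ode[].
have Fmax (x : R) : 0 < x -> F x <= F t by rewrite Ft => /F01/andP[].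
move/eqP: (is_derive_local_max t0 (F_ode t0) dF Fmax).
rewrite Ft mulf_eq0 invr_eq0 (gt_eqF t0) orbF mulf_eq0 subr_eq0.
have /andP[_ g1'] := g01 t0.
by rewrite (gt_eqF g1') orbF gt_eqF.
Qed.

(** The same argument at a minimum, carried out for -F, with g > 0. *)
Lemma ode_gt0 (t : R) : 0 < t -> 0 < F t.
Proof.
move=> t0; have /andP[Ft0 _] := F01 t0; rewrite lt_neqAle Ft0 andbT.
apply/negP => /eqP Ft.
have dNF (x : R) : 0 < x -> is_derive x 1 (- F) (- (a * (F x - g x) / x)).
  by move=> x0; apply: is_deriveN; exact: F_ode.
have dF (x : R) : 0 < x -> derivable (- F) x 1 by move=> /dNF[].
have Fmax (x : R) : 0 < x -> (- F) x <= (- F) t.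
  by rewrite !fctE -Ft oppr0 oppr_le0 => /F01/andP[].
move/eqP: (is_derive_local_max t0 (dNF t t0) dF Fmax).
rewrite -Ft sub0r oppr_eq0 mulf_eq0 invr_eq0 (gt_eqF t0) orbF mulf_eq0 oppr_eq0.
have /andP[g0' _] := g01 t0.
by rewrite (gt_eqF g0') orbF gt_eqF.
Qed.

(** By the equation this is t F' - F, the numerator of the derivative of F(t)/t; its own derivative
    is t F'', so it increases and then decreases. *)
Let D t := (a - 1) * F t - a * g t.

Let is_derive_D (t : R) : 0 < t -> is_derive t 1 D (t * F2 t).
Proof.
move=> t0; apply: (@is_derive_eq _ _ _ _ _ _ _ _
  (is_deriveB (is_deriveM (is_derive_cst (a - 1) t 1) (F_ode t0))
    (is_deriveM (is_derive_cst a t 1) (dg t)))).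
by rewrite /GRing.scale/= /F2 /F1 ?fctE; field; rewrite gt_eqF.
Qed.

Let D_within (x y : R) : 0 < x -> {within `[x, y], continuous D}.
Proof.
move=> x0; apply: (@is_derive_within_continuous _ _ (fun t => t * F2 t)) => z /andP[xz _].
by apply: is_derive_D; exact: lt_le_trans xz.
Qed.

(** Since g tends to 1, eventually a g > a - 1, whereas (a - 1) F <= a - 1. *)
Let D_lt0 (t : R) : exists2 T, t < T & D T < 0.
Proof.
have a1 : 1 - a^-1 < 1 by rewrite ltrBlDr ltrDl invr_gt0.
have : \forall x \near +oo, t < x /\ (0 < x /\ 1 - a^-1 < g x).
  near=> x; split; first by near: x; exact: nbhs_pinfty_gt (num_real _).
  by split; near: x; [exact: nbhs_pinfty_gt|exact: cvgr_gt g_cvg1 _ a1].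
case/filter_ex => T [tT [T0 gT]]; exists T => //.
have /andP[_ FT] := F01 T0.
have a_gt0' := a_gt0; have a2' := a2.
have : a * (1 - a^-1) < a * g T by rewrite ltr_pM2l.
rewrite mulrBr mulr1 divff ?gt_eqF// /D => agT.
have : (a - 1) * F T <= (a - 1) * 1 by rewrite ler_wpM2l//; lra.
lra.
Unshelve. all: by end_near. Qed.

Let is_derive_ratio (t : R) : 0 < t -> is_derive t 1 (fun t => F t / t) (D t / t ^+ 2).
Proof.
move=> t0; have tn0 : t != 0 by rewrite gt_eqF.
apply: (@is_derive_eq _ _ _ _ _ _ _ _
  (is_deriveM (F_ode t0) (is_deriveV tn0 (is_derive_id t 1)))).
by rewrite /GRing.scale/= /D; field.
Qed.

Let ratio_within (x y : R) : 0 < x -> {within `[x, y], continuous (fun t => F t / t)}.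
Proof.
move=> x0; apply: (@is_derive_within_continuous _ _ (fun t => D t / t ^+ 2)) => z /andP[xz _].
by apply: is_derive_ratio; exact: lt_le_trans xz.
Qed.

Let D_incr (ts x y : R) : (forall t, 0 < t -> t < ts -> 0 < F2 t) ->
  0 < x -> x < y -> y <= ts -> D x < D y.
Proof.
move=> F2p x0 xy yts; apply: (@is_derive_gt0_lt _ D (fun t => t * F2 t) _ _ xy).
- exact: D_within.
- by move=> z /andP[xz _]; apply: is_derive_D; exact: lt_trans xz.
- move=> z /andP[xz zy]; have z0 := lt_trans x0 xz.
  by rewrite mulr_gt0// F2p//; exact: lt_le_trans yts.
Qed.

(** [D] increases strictly on (0, ts] and satisfies D >= - a g, which tends to 0 at the origin. A
    negative value at ts/2 would therefore be exceeded at points closer to 0. *)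
Lemma ode_excess_gt0 : g 0 = 0 ->
  exists2 t0, 0 < t0 & 0 < (a - 1) * F t0 - a * g t0.
Proof.
move=> g0; have [ts [ts0 F2p _]] := F2_sign.
have h0 : 0 < ts / 2 by rewrite divr_gt0.
have hts : ts / 2 < ts by lra.
exists ts => //; apply: le_lt_trans (D_incr F2p h0 hts (lexx ts)).
rewrite leNgt; apply/negP => Dneg.
have e0 : g 0 < - D (ts / 2) / a by rewrite g0 divr_gt0 ?oppr_gt0.
have : \forall x \near 0^'+, 0 < x /\ (x < ts / 2 /\ g x < - D (ts / 2) / a).
  near=> x; split; first by near: x; exact: nbhs_right_gt.
  split; first by near: x; exact: nbhs_right_lt.
  near: x; apply: cvgr_lt e0; apply: cvg_at_right_filter.
  exact: is_derive_continuous (dg 0).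
case/filter_ex => x [x0 [xts]]; rewrite ltr_pdivlMr// => gx.
have := D_incr F2p x0 xts (ltW hts); rewrite [in X in X -> _]/D.
have /andP[Fx _] := F01 x0.
have : 0 <= (a - 1) * F x by rewrite mulr_ge0// subr_ge0 (le_trans _ a2)// ler1n.
by move: gx; rewrite /D; lra.
Unshelve. all: by end_near. Qed.

(** [D] increases up to [ts] and decreases afterwards, is positive at [t0] and hence at [ts], and is
    eventually negative. So it is positive exactly between two points [t1] and [t2], up to
    endpoints, and F(t)/t has derivative D/t^2. *)
Lemma ode_ratio_zones (t0 : R) : 0 < t0 -> 0 < (a - 1) * F t0 - a * g t0 ->
  exists t1 t2 : R, [/\ 0 <= t1, t1 < t2,
    forall x y, 0 < x -> x < y -> y <= t1 -> F y / y < F x / x,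
    forall x y, 0 < x -> t1 <= x -> x < y -> y <= t2 -> F x / x < F y / y &
    forall x y, t2 <= x -> x < y -> F y / y < F x / x].
Proof.
move=> t00 Dt0; have [ts [ts0 F2p F2n]] := F2_sign.
have Dinc := D_incr F2p.
have Ddec (x y : R) : ts <= x -> x < y -> D y < D x.
  move=> tsx xy; have x0 := lt_le_trans ts0 tsx.
  apply: (@is_derive_lt0_gt _ D (fun t => t * F2 t) _ _ xy).
  - exact: D_within.
  - by move=> z /andP[xz _]; apply: is_derive_D; exact: lt_trans xz.
  - move=> z /andP[xz zy]; have z0 := lt_trans x0 xz.
    by rewrite pmulr_rlt0// F2n//; exact: le_lt_trans xz.
have Dts : 0 < D ts.
  apply: lt_le_trans Dt0 _; have [t0ts|tst0|->//] := ltgtP t0 ts; apply: ltW.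
    exact: Dinc.
  exact: Ddec.
have [T tsT DT] := D_lt0 ts.
have [|t2] := @IVT R D ts T 0 (ltW tsT) (@D_within ts T ts0).
  by rewrite ge_min le_max (ltW Dts) (ltW DT) orbT.
rewrite in_itv/= => /andP[tst2 t2T] Dt2.
have {}tst2 : ts < t2.
  by rewrite lt_neqAle tst2 andbT; apply/eqP => E; rewrite E Dt2 ltxx in Dts.
(* [D] may be positive all the way down to 0, as it is when g(0) = 0. The left end [t1] is therefore
   an infimum rather than a root, and for t1 = 0 the first decreasing zone is empty. *)
pose A := [set x | 0 < x <= ts /\ 0 < D x]%classic.
have Ats : A ts by rewrite /A/= ts0 lexx.
have lbA : lbound A 0 by move=> x [/andP[/ltW]].
have A0 : (A !=set0)%classic by exists ts.
pose t1 := inf A.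
have t10 : 0 <= t1 by exact: lb_le_inf.
have t1ts : t1 <= ts by apply: ge_inf => //; exists 0.
have Dpos1 (x : R) : t1 < x -> x <= ts -> 0 < D x.
  move=> t1x xts; have [y [/andP[y0 yts] Dy] yx] := inf_lt A0 t1x.
  by apply: lt_trans Dy _; exact: Dinc.
have Dpos (x : R) : t1 < x -> x < t2 -> 0 < D x.
  move=> t1x xt2; have [|/ltW tsx] := leP x ts; first exact: Dpos1.
  by rewrite -Dt2; exact: Ddec.
have Dneg2 (x : R) : t2 < x -> D x < 0.
  by move=> t2x; rewrite -Dt2; apply: Ddec => //; exact: ltW.
have Dneg1 (x : R) : 0 < x -> x < t1 -> D x < 0.
  move=> x0 xt1; pose y := (x + t1) / 2.
  have xy : x < y by rewrite /y; lra.
  have yt1 : y < t1 by rewrite /y; lra.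
  have yts := le_trans (ltW yt1) t1ts.
  apply: lt_le_trans (Dinc _ _ x0 xy yts) _; rewrite leNgt; apply/negP => Dy.
  have /ge_inf : A y by rewrite /A/= yts andbT (lt_trans x0 xy).
  by move=> /(_ (ex_intro _ 0 lbA)); rewrite leNgt yt1.
have dec (x y : R) : 0 < x -> x < y -> (forall z, x < z < y -> D z < 0) -> F y / y < F x / x.
  move=> x0 xy Dz; apply: (@is_derive_lt0_gt _ (fun t => F t / t)
    (fun t => D t / t ^+ 2) _ _ xy).
  - exact: ratio_within.
  - by move=> z /andP[xz _]; apply: is_derive_ratio; exact: lt_trans xz.
  - move=> z xzy; have /andP[xz _] := xzy; have z0 := lt_trans x0 xz.
    by rewrite pmulr_llt0 ?Dz// invr_gt0 exprn_gt0.
exists t1, t2; split => //.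
- exact: le_lt_trans tst2.
- move=> x y x0 xy yt1; apply: dec => // z /andP[xz zy].
  by apply: Dneg1; [exact: lt_trans xz|exact: lt_le_trans yt1].
- move=> x y x0 t1x xy yt2.
  apply: (@is_derive_gt0_lt _ (fun t => F t / t)
    (fun t => D t / t ^+ 2) _ _ xy).
  + exact: ratio_within.
  + by move=> z /andP[xz _]; apply: is_derive_ratio; exact: lt_trans xz.
  + move=> z /andP[xz zy]; have z0 := lt_trans x0 xz.
    rewrite divr_gt0 ?exprn_gt0// Dpos//; first exact: le_lt_trans xz.
    exact: lt_le_trans yt2.
- move=> x y t2x xy; apply: dec => //.
    by apply: lt_le_trans t2x; exact: lt_trans tst2.
  by move=> z /andP[xz _]; apply: Dneg2; exact: le_lt_trans xz.
Qed.

End averaging_ode.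

(** * Maximizers with a quadratic penalty *)

Section quadratic_argmax.
Context (R : realType) (t1 t2 : R) (Phi F : R -> R).
Hypotheses (t1_ge0 : 0 <= t1) (t12 : t1 < t2).
Hypothesis cPhi : continuous Phi.
Hypothesis dPhi : forall t : R, 0 < t -> is_derive t 1 Phi (F t).
Hypothesis cF : forall t : R, 0 < t -> {for t, continuous F}.
Hypothesis F_gt0 : forall t : R, 0 < t -> 0 < F t.
Hypothesis F_lt1 : forall t : R, 0 < t -> F t < 1.
Hypothesis dec1 : forall x y : R, 0 < x -> x < y -> y <= t1 -> F y / y < F x / x.
Hypothesis inc12 : forall x y : R,
  0 < x -> t1 <= x -> x < y -> y <= t2 -> F x / x < F y / y.
Hypothesis dec2 : forall x y : R, t2 <= x -> x < y -> F y / y < F x / x.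

Definition penalized (b t : R) : R := Phi t - t ^+ 2 / (2 * b).

(** The range [0, b] is the image of 0 <= s <= 1 under t = b s, so it grows with b. *)
Definition penalized_argmax (b : R) : set R :=
  [set t | 0 <= t <= b /\ forall v, 0 <= v <= b -> penalized b v <= penalized b t].

Let t2_gt0 : 0 < t2. Proof. exact: le_lt_trans t12. Qed.

Let continuous_penalized (b : R) : continuous (penalized b).
Proof.
move=> x; apply: cvgB; first exact: cPhi.
apply: cvgM; last exact: cvg_cst.
exact: exprn_continuous.
Qed.

Let is_derive_penalized (b t : R) : 0 < b -> 0 < t ->
  is_derive t 1 (penalized b) (F t - t / b).
Proof.
move=> b0 t0; apply: (@is_derive_eq _ _ _ _ _ _ _ _
  (is_deriveB (dPhi t0) (is_deriveM (is_deriveX 2 (is_derive_id t 1))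
    (is_derive_cst (2 * b)^-1 t 1)))).
by rewrite /GRing.scale/= ?fctE; field; rewrite gt_eqF.
Qed.

Let penalized_lt (b x y : R) : 0 < b -> 0 <= x -> x < y ->
  (forall z, x < z < y -> b^-1 < F z / z) -> penalized b x < penalized b y.
Proof.
move=> b0 x0 xy Fz; apply: (@is_derive_gt0_lt _ (penalized b) (fun z => F z - z / b)) => //.
- exact: continuous_subspaceT.
- by move=> z /andP[xz _]; apply: is_derive_penalized => //; exact: le_lt_trans xz.
- move=> z xzy; have z0 : 0 < z by case/andP: xzy => xz _; exact: le_lt_trans xz.
  by have := Fz z xzy; rewrite ltr_pdivlMr// mulrC subr_gt0.
Qed.

Lemma penalized_argmax_neq0 (b : R) : 0 < b -> penalized_argmax b !=set0.
Proof.
move=> b0; have [c + cmax] := @EVT_max R (penalized b) 0 b (ltW b0)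
  (continuous_subspaceT (@continuous_penalized b)).
by rewrite in_itv/= => c0b; exists c; split.
Qed.

(** At the right end t = b the derivative F(b) - b/b is negative because F < 1. Every positive
    maximizer is therefore interior, hence a critical point. *)
Let argmax_lt (b t : R) : 0 < b -> penalized_argmax b t -> t < b.
Proof.
move=> b0 [/andP[t0 tb] tmax]; rewrite lt_neqAle tb andbT; apply/negP => /eqP Eb.
subst b.
have : (fun z => F z - z / t) z @[z --> t] --> F t - t / t.
  by apply: cvgB; [exact: cF|apply: cvgM; [exact: cvg_id|exact: cvg_cst]].
have Ft : F t - t / t < 0 by rewrite divff ?gt_eqF// subr_lt0 F_lt1.
move=> /cvgr_lt/(_ _ Ft) /nbhs_ballP[e /= e0 te].
(* A positive point to the left of t, close enough for the derivative to remain negative on (x,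
   t). *)
pose x := Num.max (t / 2) (t - e / 2).
have xt : x < t by rewrite gt_max; apply/andP; split; lra.
have x0 : 0 < x by rewrite lt_max; apply/orP; left; rewrite divr_gt0.
have : penalized t t < penalized t x.
  apply: (@is_derive_lt0_gt _ (penalized t) (fun z => F z - z / t)) => //.
  - exact: continuous_subspaceT.
  - by move=> z /andP[xz _]; apply: is_derive_penalized => //; exact: lt_trans xz.
  - move=> z /andP[xz zt]; apply: te; rewrite /ball/= ltr_norml.
    have : t - e / 2 < z by apply: le_lt_trans xz; rewrite le_max lexx orbT.
    by move=> ?; apply/andP; split; lra.
by rewrite ltNge tmax// ltW//= ltW.
Qed.

Let argmax_critical (b t : R) : 0 < b -> penalized_argmax b t -> 0 < t ->
  F t / t = b^-1.
Proof.
move=> b0 tm t0; have tb := argmax_lt b0 tm; case: tm => _ tmax.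
have [||| _ E] := @derive1_at_max R (penalized b) 0 b t (ltW b0).
- by move=> x; rewrite in_itv/= => /andP[x0 _]; have [] := is_derive_penalized b0 x0.
- by rewrite in_itv/= t0.
- by move=> x; rewrite in_itv/= => /andP[x0 xb]; apply: tmax; rewrite !ltW.
have [_ E'] := is_derive_penalized b0 t0.
move: E; rewrite E' => /eqP; rewrite subr_eq0 => /eqP ->.
by rewrite mulrAC divff ?mul1r// gt_eqF.
Qed.

(** At a maximizer inside (t1, t2) one has F(t)/t = 1/b, and F(z)/z is larger just to the right, so
    the penalized function would still be increasing there. *)
Lemma penalized_argmax_zone (b t : R) : 0 < b -> penalized_argmax b t ->
  t <= t1 \/ t2 <= t.
Proof.
move=> b0 tm; have [|t1t] := leP t t1; first by left.
have [|tt2] := leP t2 t; first by right.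
have t0 : 0 < t by exact: le_lt_trans t1t.
(* Going no further than this point keeps the comparison within the admissible range and within the
   zone where F(z)/z increases. *)
pose y := Num.min b t2.
have ty : t < y by rewrite lt_min (argmax_lt b0 tm).
have := penalized_lt b0 (ltW t0) ty; rewrite ltNge (proj2 tm); last first.
  by rewrite (ltW (lt_trans t0 ty)) ge_min lexx.
move=> H; suff /H : forall z, t < z < y -> b^-1 < F z / z by [].
move=> z /andP[tz zy]; rewrite -(argmax_critical b0 tm t0).
apply: inc12 => //; first exact: ltW.
by rewrite ltW// (lt_le_trans zy)// ge_min lexx orbT.
Qed.

(** If u < v lie in one decreasing zone, then F(z)/z > F(v)/v = 1/b between them, so v beats u. Only
    v needs to be critical, which allows u = 0. *)
Let argmax_no_lt (b u v : R) : 0 < b -> penalized_argmax b u ->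
  penalized_argmax b v -> u < v -> v <= t1 \/ t2 <= u -> False.
Proof.
move=> b0 um vm uv uvz; have u0 : 0 <= u by case: um => /andP[].
have v0 := le_lt_trans u0 uv.
have := penalized_lt b0 u0 uv; rewrite ltNge (proj2 um) ?(proj1 vm)//.
move=> H; suff /H : forall z, u < z < v -> b^-1 < F z / z by [].
move=> z /andP[uz zv]; rewrite -(argmax_critical b0 vm v0).
have z0 := le_lt_trans u0 uz.
case: uvz => [vt1|t2u]; first exact: dec1.
by apply: dec2 => //; rewrite ltW// (le_lt_trans t2u).
Qed.

(** Exchange argument: adding the two optimality inequalities cancels [Phi] and leaves (t^2 -
    t'^2)(1/(2b) - 1/(2b')) <= 0. *)
Lemma penalized_argmax_mono (b b' t t' : R) : 0 < b -> b < b' ->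
  penalized_argmax b t -> penalized_argmax b' t' -> t <= t'.
Proof.
move=> b0 bb' [/andP[t0 tb] tmax] [/andP[t'0 t'b'] t'max].
(* If t' exceeds b it is not a competitor for the parameter b, but then t <= b <= t' already. *)
have [t'b|/ltW bt'] := leP t' b; last exact: le_trans bt'.
have b'0 := lt_trans b0 bb'.
have h1 := tmax t'; have h2 := t'max t.
rewrite t'0 t'b in h1; rewrite t0 (le_trans tb (ltW bb')) in h2.
have := lerD (h1 isT) (h2 isT); rewrite /penalized => {h1 h2} h.
rewrite leNgt; apply/negP => t't.
have tt : t' ^+ 2 < t ^+ 2 by rewrite ltr_pXn2r.
have k : (2 * b')^-1 < (2 * b)^-1 by rewrite ltf_pV2 ?posrE ?mulr_gt0// ltr_pM2l.
have : 0 < (t ^+ 2 - t' ^+ 2) * ((2 * b)^-1 - (2 * b')^-1) by rewrite mulr_gt0 ?subr_gt0.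
rewrite mulrBl !mulrBr.
move: h; lra.
Qed.

(** [bc] is the supremum of the parameters with a maximizer in [0, t1]. Monotonicity keeps all
    maximizers for b < bc in that zone, those for b > bc lie beyond [t2] by definition of the
    supremum, and [argmax_no_lt] gives uniqueness within each zone. *)
Lemma penalized_argmax_transition : exists bc : R, [/\ 0 < bc,
  forall b, 0 < b -> b != bc -> exists! t, penalized_argmax b t,
  forall b t, 0 < b -> b < bc -> penalized_argmax b t -> t <= t1 &
  forall b t, bc < b -> penalized_argmax b t -> t2 <= t].
Proof.
pose A := [set b : R | 0 < b /\ exists2 t, penalized_argmax b t & t <= t1].
(* For b < t2 the range [0, b] does not reach the upper zone. *)
have A2 : A (t2 / 2).
  have b0 : 0 < t2 / 2 by rewrite divr_gt0.
  split => //; have [t tm] := penalized_argmax_neq0 b0; exists t => //.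
  case: (penalized_argmax_zone b0 tm) => // t2t; exfalso.
  case: tm => /andP[_ tb] _; have := t2_gt0; lra.
have Phi_le (x y : R) : 0 <= x -> x < y -> Phi x < Phi y.
  move=> x0 xy; apply: (@is_derive_gt0_lt _ Phi F) => //.
  - exact: continuous_subspaceT.
  - by move=> z /andP[xz _]; apply: dPhi; exact: le_lt_trans xz.
  - by move=> z /andP[xz _]; apply: F_gt0; exact: le_lt_trans xz.
have dP : 0 < Phi t2 - Phi t1 by rewrite subr_gt0 Phi_le.
(* For large [b] the penalty at [t2] is less than [Phi t2 - Phi t1]. *)
pose M := Num.max t2 (t2 ^+ 2 / (Phi t2 - Phi t1)).
have ubA : ubound A M.
  move=> b [b0 [t tm tt1]]; rewrite leNgt; apply/negP.
  rewrite gt_max => /andP[t2b]; rewrite ltr_pdivrMr// => h.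
  have [/andP[t0 tb] tmax] := tm.
  have /tmax : 0 <= t2 <= b by rewrite !ltW.
  rewrite /penalized; apply/negP; rewrite -ltNge.
  apply: (@le_lt_trans _ _ (Phi t1)).
    apply: (@le_trans _ _ (Phi t)).
      by rewrite lerBlDr lerDl divr_ge0 ?sqr_ge0// mulr_ge0// ltW.
    move: tt1; rewrite le_eqVlt => /orP[/eqP ->//|tt1].
    by apply: ltW; exact: Phi_le.
  rewrite ltrBrDl -ltrBrDr ltr_pdivrMr ?mulr_gt0//.
  by apply: lt_le_trans h _; rewrite mulrC ler_pM2l//; lra.
have hA : has_ubound A by exists M.
have supA : t2 / 2 <= sup A by exact: ub_le_sup.
exists (sup A).
have zone1 b t : 0 < b -> b < sup A -> penalized_argmax b t -> t <= t1.
  move=> b0 bA tm; have [b' [b'0 [t' tm' t't1]] bb'] := sup_gt (ex_intro _ _ A2) bA.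
  exact: le_trans (penalized_argmax_mono b0 bb' tm tm') t't1.
have supA0 : 0 < sup A by apply: lt_le_trans supA; rewrite divr_gt0.
have zone2 b t : sup A < b -> penalized_argmax b t -> t2 <= t.
  move=> bA tm; have b0 := lt_trans supA0 bA.
  case: (penalized_argmax_zone b0 tm) => // tt1; exfalso.
  have /(ub_le_sup hA) : A b by split=> //; exists t.
  by rewrite leNgt bA.
split => // b b0 bA; have [t tm] := penalized_argmax_neq0 b0.
exists t; split => // t' tm'.
have same : (t <= t1 /\ t' <= t1) \/ (t2 <= t /\ t2 <= t').
  have [bl|bg|E] := ltgtP b (sup A).
  - by left; split; apply: zone1 tm || apply: zone1 tm'.
  - by right; split; apply: zone2 tm || apply: zone2 tm'.
  - by rewrite E eqxx in bA.
have [tt'|t't|//] := ltgtP t t'.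
- exfalso; apply: argmax_no_lt tm tm' tt' _ => //.
  by case: same => -[? ?]; [left|right].
- exfalso; apply: argmax_no_lt tm' tm t't _ => //.
  by case: same => -[? ?]; [left|right].
Qed.

End quadratic_argmax.

(** * The Potts functions *)

Section potts_functions.
Context (R : realType) (k B : R).
Hypothesis k3 : 3 <= k.

Definition potts_den (x : R) : R := expR (x + B) + k - 1.
Definition potts_ratio (x : R) : R := (expR (x + B) - 1) / (expR (x + B) + k - 1).
Definition potts_ratio1 (x : R) : R := k * expR (x + B) / potts_den x ^+ 2.
Definition potts_ratio2 (x : R) : R :=
  k * expR (x + B) * (k - 1 - expR (x + B)) / potts_den x ^+ 3.
Definition potts_log (x : R) : R := ln (expR (x + B) + k - 1).
(** The derivative of [potts_log], and by [potts_weightE] an affine function of [potts_ratio]; this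
    ties the derivative of the pressure to F. *)
Definition potts_weight (x : R) : R := expR (x + B) / potts_den x.

Lemma potts_den_gt0 x : 0 < potts_den x.
Proof. by rewrite /potts_den; have := expR_gt0 (x + B); have := k3; lra. Qed.

Lemma is_derive_expR_shift (x : R) : is_derive x 1 (fun x => expR (x + B)) (expR (x + B)).
Proof.
have H : is_derive x 1 (fun x : R => x + B) 1.
  apply: is_derive_eq (is_deriveD (is_derive_id x 1) (is_derive_cst B x 1)) _.
  by rewrite addr0.
apply: (@is_derive_eq _ _ _ _ _ _ _ _
  (@is_derive1_comp _ expR (fun x : R => x + B) x _ _ (is_derive_expR _) H)).
by rewrite mulr1.
Qed.

Lemma is_derive_potts_den (x : R) : is_derive x 1 potts_den (expR (x + B)).
Proof.
apply: (@is_derive_eq _ _ _ _ _ _ _ _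
  (is_deriveB (is_deriveD (is_derive_expR_shift x) (is_derive_cst k x 1))
    (is_derive_cst (1 : R) x 1))).
by rewrite addr0 subr0.
Qed.

Lemma is_derive_potts_ratio (x : R) : is_derive x 1 potts_ratio (potts_ratio1 x).
Proof.
have D0 : potts_den x != 0 by rewrite gt_eqF ?potts_den_gt0.
apply: (@is_derive_eq _ _ _ _ _ _ _ _
  (is_deriveM (is_deriveB (is_derive_expR_shift x) (is_derive_cst (1 : R) x 1))
    (is_deriveV D0 (is_derive_potts_den x)))).
rewrite /GRing.scale/= ?fctE /potts_ratio1; move: D0; rewrite /potts_den => D0; field.
exact: D0.
Qed.

Lemma is_derive_potts_ratio1 (x : R) : is_derive x 1 potts_ratio1 (potts_ratio2 x).
Proof.
have D0 : potts_den x ^+ 2 != 0 by rewrite expf_neq0// gt_eqF ?potts_den_gt0.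
have D2 : is_derive x 1 (fun x => potts_den x ^+ 2) (2 * potts_den x * expR (x + B)).
  by apply: is_derive_eq (is_deriveX 2 (is_derive_potts_den x)) _.
apply: (@is_derive_eq _ _ _ _ _ _ _ _
  (is_deriveM (is_deriveM (is_derive_cst k x 1) (is_derive_expR_shift x))
    (@is_deriveV _ (fun x => potts_den x ^+ 2) _ _ _ D0 D2))).
rewrite /GRing.scale/= ?fctE /potts_ratio2.
have D1 : potts_den x != 0 by rewrite gt_eqF ?potts_den_gt0.
move: D0 D1; rewrite /potts_den => D0 D1; field.
exact: D1.
Qed.

Lemma continuous_potts_ratio : continuous potts_ratio.
Proof. by move=> x; exact: is_derive_continuous (is_derive_potts_ratio x). Qed.

Lemma potts_ratioE x : potts_ratio x = 1 - k / potts_den x.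
Proof.
have D0 : potts_den x != 0 by rewrite gt_eqF ?potts_den_gt0.
by move: D0; rewrite /potts_ratio /potts_den => D0; field.
Qed.

Lemma potts_ratio_lt1 x : potts_ratio x < 1.
Proof.
rewrite potts_ratioE ltrBlDr ltrDl divr_gt0 ?potts_den_gt0//.
by have := k3; lra.
Qed.

Lemma potts_ratio_cvg1 : potts_ratio x @[x --> +oo] --> (1 : R).
Proof.
have k0 : 0 < k by have := k3; lra.
apply/cvgrPdist_lt => e e0; near=> x.
rewrite potts_ratioE opprB addrCA subrr addr0 ger0_norm; last first.
  by rewrite divr_ge0 ?(ltW k0) ?(ltW (potts_den_gt0 _)).
rewrite ltr_pdivrMr ?potts_den_gt0// mulrC -ltr_pdivrMr//.
have h : ln (k / e) - B < x by near: x; exact: nbhs_pinfty_gt (num_real _).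
have : k / e < expR (x + B).
  by rewrite -ltr_ln ?posrE ?expR_gt0 ?divr_gt0// expRK; lra.
by move=> h'; rewrite /potts_den; have := k3; lra.
Unshelve. all: by end_near. Qed.

Lemma is_derive_potts_log (x : R) : is_derive x 1 potts_log (potts_weight x).
Proof.
apply: (@is_derive_eq _ _ _ _ _ _ _ _
  (is_derive1_comp (is_derive1_ln (potts_den_gt0 x)) (is_derive_potts_den x))).
by rewrite mulrC.
Qed.

Lemma potts_weightE x : potts_weight x = k^-1 + (k - 1) / k * potts_ratio x.
Proof.
have D0 : potts_den x != 0 by rewrite gt_eqF ?potts_den_gt0.
have k0 : k != 0 by rewrite gt_eqF//; have := k3; lra.
by move: D0; rewrite /potts_weight /potts_ratio /potts_den => D0; field; rewrite k0 ?D0.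
Qed.

Lemma potts_weight01 x : 0 <= potts_weight x <= 1.
Proof.
rewrite divr_ge0 ?expR_ge0 ?(ltW (potts_den_gt0 _))//=.
by rewrite ler_pdivrMr ?potts_den_gt0// /potts_den mul1r; have := k3; lra.
Qed.

Lemma potts_ratio_le (x y : R) : x <= y -> potts_ratio x <= potts_ratio y.
Proof.
move=> xy; rewrite !potts_ratioE lerB// ler_pM2l; last by have := k3; lra.
rewrite lef_pV2 ?posrE ?potts_den_gt0// /potts_den.
have : expR (x + B) <= expR (y + B) by rewrite ler_expR lerD2r.
lra.
Qed.

Lemma potts_weight_le (x y : R) : x <= y -> potts_weight x <= potts_weight y.
Proof.
move=> xy; rewrite !potts_weightE lerD2l ler_wpM2l ?potts_ratio_le//.
by rewrite divr_ge0//; have := k3; lra.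
Qed.

(** Mean value theorem with an increasing derivative. Bounds on increments, unlike derivatives, pass
    to expectations directly. *)
Lemma potts_log_convex (x y : R) : x <= y ->
  (y - x) * potts_weight x <= potts_log y - potts_log x <= (y - x) * potts_weight y.
Proof.
move=> xy; have [||c] := @MVT_segment R potts_log potts_weight x y xy.
- by move=> z _; exact: is_derive_potts_log.
- by apply: (@is_derive_within_continuous _ _ potts_weight) => z _; exact: is_derive_potts_log.
rewrite in_itv/= => /andP[xc cy] ->.
by rewrite ![_ * (y - x)]mulrC !ler_wpM2l ?subr_ge0 ?potts_weight_le.
Qed.

Lemma potts_log_le (x : R) : 0 <= potts_log x <= `|x| + (`|B| + ln k).
Proof.
have k0 : 0 < k by have := k3; lra.
have ek := expR_gt0 (x + B).
apply/andP; split; first by rewrite -ln1 ler_ln ?posrE ?potts_den_gt0//; have := k3; lra.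
rewrite -[leRHS]expRK /potts_log ler_ln ?posrE ?expR_gt0 ?potts_den_gt0//.
rewrite addrA [leRHS]expRD lnK ?posrE//.
have e1 : 1 <= expR (`|x| + `|B|) by rewrite -expR0 ler_expR addr_ge0.
have e2 : expR (x + B) <= expR (`|x| + `|B|) by rewrite ler_expR lerD ?ler_norm.
have k3' := k3; nra.
Qed.

Hypothesis B0 : 0 <= B.

Lemma expR_shift_ge1 x : 0 <= x -> 1 <= expR (x + B).
Proof. by move=> x0; rewrite -expR0 ler_expR addr_ge0. Qed.

Lemma potts_ratio01 x : 0 <= x -> 0 <= potts_ratio x <= 1.
Proof.
move=> x0; rewrite (ltW (potts_ratio_lt1 x)) andbT divr_ge0//.
  by rewrite subr_ge0 expR_shift_ge1.
by have := potts_den_gt0 x; rewrite /potts_den => /ltW.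
Qed.

Lemma potts_ratio_gt0 x : 0 < x -> 0 < potts_ratio x.
Proof.
move=> x0; rewrite divr_gt0//; last exact: potts_den_gt0.
by rewrite subr_gt0 -expR0 ltr_expR ltr_pwDl.
Qed.

Lemma potts_ratio1_le1 x : 0 < x -> `|potts_ratio1 x| <= 1.
Proof.
move=> x0; have e1 := expR_shift_ge1 (ltW x0).
have D0 := potts_den_gt0 x; have k3' := k3.
rewrite ger0_norm; last by rewrite divr_ge0 ?exprn_ge0 ?(ltW D0)// mulr_ge0//; lra.
rewrite ler_pdivrMr ?exprn_gt0// mul1r expr2.
apply: ler_pM; rewrite /potts_den; lra.
Qed.

Hypothesis kB : 1 < expR (- B) * (k - 1).

Let u0 := ln (k - 1) - B.

Lemma potts_inflection_gt0 : 0 < u0.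
Proof.
rewrite subr_gt0 -ltr_expR lnK ?posrE; last by have := k3; lra.
by move: kB; rewrite expRN mulrC ltr_pdivlMr ?expR_gt0// mul1r.
Qed.

Lemma expR_shift_inflection x : (expR (x + B) < k - 1) = (x < u0).
Proof.
by rewrite [in RHS]ltrBrDr -[in RHS]ltr_expR lnK// posrE; have := k3; lra.
Qed.

Lemma potts_ratio2_gt0 x : x < u0 -> 0 < potts_ratio2 x.
Proof.
rewrite -expR_shift_inflection => h.
have k0 : 0 < k by have := k3; lra.
by rewrite divr_gt0 ?exprn_gt0 ?potts_den_gt0// mulr_gt0 ?subr_gt0// mulr_gt0 ?expR_gt0.
Qed.

Lemma potts_ratio2_lt0 x : u0 < x -> potts_ratio2 x < 0.
Proof.
move=> ux; have h : k - 1 < expR (x + B).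
  by move: ux; rewrite ltrBlDr -ltr_expR lnK// posrE; have := k3; lra.
have k0 : 0 < k by have := k3; lra.
rewrite pmulr_llt0 ?invr_gt0 ?exprn_gt0 ?potts_den_gt0//.
by rewrite pmulr_rlt0 ?subr_lt0// mulr_gt0 ?expR_gt0.
Qed.

(** The second derivative vanishes at [u0], so a uniform bound needs a shorter interval. For 0 < x <
    u0/2 one has 1 <= e^(x+B) < E < k - 1, and the denominator is below (2(k - 1))^3. *)
Lemma potts_ratio2_ge : exists2 m, 0 < m &
  forall x, 0 < x < u0 / 2 -> m <= potts_ratio2 x.
Proof.
have k3' := k3; have u00 := potts_inflection_gt0.
pose E := expR (u0 / 2 + B).
have Ek : E < k - 1 by rewrite expR_shift_inflection; lra.
exists (k * (k - 1 - E) / (2 * (k - 1)) ^+ 3).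
  by rewrite divr_gt0 ?exprn_gt0 ?mulr_gt0 ?subr_gt0//; lra.
move=> x /andP[x0 xu]; have e1 := expR_shift_ge1 (ltW x0).
have eE : expR (x + B) < E by rewrite ltr_expR ltrD2r.
have D0 := potts_den_gt0 x.
apply: ler_pM.
- by rewrite mulr_ge0 ?subr_ge0 ?(ltW Ek)//; lra.
- by rewrite invr_ge0 exprn_ge0//; lra.
- by apply: ler_pM; [lra|lra| |lra]; rewrite ler_peMr//; lra.
- rewrite lef_pV2 ?posrE ?exprn_gt0 ?mulr_gt0//; [|lra].
  by rewrite lerXn2r ?nnegrE ?(ltW D0)// /potts_den; lra.
Qed.

End potts_functions.

(** * Pareto means *)

(** A substitute for differentiation under the expectation: once averaged, the slope bounds of a
    convex function still determine the derivative wherever the averaged slope is continuous. The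
    proof goes through Carathéodory's criterion. *)
Lemma is_derive_of_increments (R : realType) (L S : R -> R) (t : R) :
  (forall x y, x <= y -> (y - x) * S x <= L y - L x <= (y - x) * S y) ->
  {for t, continuous S} -> is_derive t 1 L (S t).
Proof.
move=> LS cS; apply/is_derive1_caratheodory.
pose g z := if z == t then S t else (L z - L t) / (z - t).
exists g; split; last by rewrite /g eqxx.
  move=> z; rewrite /g; case: eqVneq => [->|zt]; first by rewrite !subrr mulr0.
  by rewrite divfK// subr_eq0.
(* The difference quotient [g z] lies between [S t] and [S z]. *)
have gS z : `|S t - g z| <= `|S t - S z|.
  rewrite /g; case: eqVneq => [->//|zt].
  have [zt'|tz|/eqP] := ltgtP z t; last by rewrite (negbTE zt).
    have /andP[h1 h2] := LS _ _ (ltW zt').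
    have d0 : 0 < t - z by rewrite subr_gt0.
    have -> : (L z - L t) / (z - t) = (L t - L z) / (t - z).
      by rewrite -(opprB t z) -(opprB (L t)) invrN mulrNN.
    have q1 : S z <= (L t - L z) / (t - z) by rewrite ler_pdivlMr// mulrC.
    have q2 : (L t - L z) / (t - z) <= S t by rewrite ler_pdivrMr// mulrC.
    by rewrite !ger0_norm ?subr_ge0//; [rewrite lerB|exact: le_trans q2].
  have /andP[h1 h2] := LS _ _ (ltW tz).
  have d0 : 0 < z - t by rewrite subr_gt0.
  have q1 : S t <= (L z - L t) / (z - t) by rewrite ler_pdivlMr// mulrC.
  have q2 : (L z - L t) / (z - t) <= S z by rewrite ler_pdivrMr// mulrC.
  by rewrite !ler0_norm ?subr_le0// ?(le_trans q1)// lerN2 lerB.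
have gt : g t = S t by rewrite /g eqxx.
rewrite /prop_for /continuous_at gt; apply/cvgrPdist_lt => e e0.
have /cvgrPdist_lt/(_ e e0) := cS.
by apply: filterS => z; exact: le_lt_trans.
Qed.

Section pareto_integral.
Context (R : realType) (a : R).
Hypothesis a0 : 0 < a.
Notation mu := (@lebesgue_measure R).
Notation tau := (a + 2).

Definition pareto_mean (phi : R -> R) : R :=
  Rintegral mu `[1, +oo[ (fun w => phi w * ((tau - 1) * w `^ (- tau))).

Let tau1 : 0 < tau - 1. Proof. by have := a0; lra. Qed.

Let weightE (w : R) : 1 <= w -> w * ((tau - 1) * w `^ (- tau)) = (tau - 1) * w `^ (- a - 1).
Proof.
move=> w1; have w0 : 0 < w by exact: lt_le_trans w1.
rewrite mulrCA -{1}(powRr1 (ltW w0)) -powRD ?(gt_eqF w0) ?implybT//.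
by congr (_ * _ `^ _); lra.
Qed.

Lemma pareto_integrable (phi : R -> R) (C : R) : measurable_fun setT phi ->
  (forall w, 1 <= w -> `|phi w| <= C * w) ->
  mu.-integrable `[1, +oo[ (EFin \o (fun w => phi w * ((tau - 1) * w `^ (- tau)))).
Proof.
move=> mphi phiC.
have H : mu.-integrable `[1, +oo[ (EFin \o (fun u => C * (tau - 1) * u `^ (- a - 1))).
  have := integrable_powRN_itvy a0 ltr01.
  move=> /(integrableZl _ (C * (tau - 1))) => /(_ (measurable_itv _)).
  by apply: eq_integrable => //.
apply: le_integrable H => //.
  apply/measurable_EFinP; apply: measurable_funM; first exact: measurable_funTS.
  by apply: measurable_funM => //; apply: measurable_funTS; exact: measurable_powR.
move=> w /=; rewrite in_itv/= andbT => w1; have w0 : 0 < w by exact: lt_le_trans w1.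
have phi_w := phiC w w1.
have Cw : 0 <= C * w by exact: le_trans (normr_ge0 _) phi_w.
have C0 : 0 <= C by rewrite -(pmulr_lge0 _ w0).
rewrite lee_fin [leRHS]ger0_norm ?mulr_ge0 ?powR_ge0 ?(ltW tau1)//.
rewrite normrM (ger0_norm (_ : 0 <= (tau - 1) * _)) ?mulr_ge0 ?powR_ge0 ?(ltW tau1)//.
rewrite -mulrA -weightE// mulrA ler_wpM2r// mulr_ge0 ?powR_ge0 ?(ltW tau1)//.
Qed.

Lemma pareto_mean_id : pareto_mean id = (tau - 1) / a.
Proof.
transitivity (Rintegral mu `[1, +oo[ (fun w => (tau - 1) * w `^ (- a - 1))).
  by apply: eq_Rintegral => w; rewrite inE/= in_itv/= andbT => /weightE.
rewrite RintegralZl//; last exact: integrable_powRN_itvy.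
by rewrite /Rintegral integral_powRN_itvy// powR1 mul1r.
Qed.

Lemma pareto_mean_scale (h : R -> R) (t : R) : 0 < t -> continuous h ->
  (forall x, 0 <= x -> 0 <= h x <= 1) ->
  pareto_mean (fun w => w * h (t * w)) = (tau - 1) * (t `^ a * power_tail a h t).
Proof.
move=> t0 ch h01.
transitivity (Rintegral mu `[1, +oo[ (fun w => (tau - 1) * (w * h (t * w) * w `^ (- tau)))).
  by apply: eq_Rintegral => w _; rewrite mulrCA.
rewrite RintegralZl//; last first.
  have mh : measurable_fun setT (fun w : R => w * h (t * w)).
    apply: measurable_funM => //; apply: continuous_measurable_fun => x.
    by apply: continuous_comp; [exact: mulrl_continuous|exact: ch].
  have /(pareto_integrable mh) : forall w, 1 <= w -> `|w * h (t * w)| <= 1 * w.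
    move=> w w1; have w0 : 0 < w by exact: lt_le_trans w1.
    have /andP[h0 h1] := h01 (t * w) (ltW (mulr_gt0 t0 w0)).
    by rewrite ger0_norm ?mulr_ge0 ?(ltW w0)// mulrC ler_wpM2r// ltW.
  move=> /(integrableZl _ (tau - 1)^-1) => /(_ (measurable_itv _)).
  apply: eq_integrable => // w _ /=; rewrite -EFinM; congr EFin.
  by have t0' := gt_eqF tau1; field; rewrite t0'.
by rewrite {1}/Rintegral power_tail_scale.
Qed.

(** For a > 0 the law with exponent a + 2 has a finite mean, so this growth condition guarantees
    integrability; it is also stable under linear combinations. *)
Definition linearly_bounded (phi : R -> R) : Prop := measurable_fun setT phi /\
  exists C : R, forall w, 1 <= w -> `|phi w| <= C * w.

Let integrable_lb (phi : R -> R) : linearly_bounded phi ->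
  mu.-integrable `[1, +oo[ (EFin \o (fun w => phi w * ((tau - 1) * w `^ (- tau)))).
Proof. by case=> mphi [C]; exact: pareto_integrable. Qed.

Lemma linearly_boundedZ (c : R) (phi : R -> R) : linearly_bounded phi ->
  linearly_bounded (fun w => c * phi w).
Proof.
case=> mphi [C hC]; split; first exact: measurable_funM.
exists (`|c| * C) => w w1; rewrite normrM -mulrA ler_wpM2l//.
exact: hC.
Qed.

Lemma linearly_boundedD (phi psi : R -> R) : linearly_bounded phi ->
  linearly_bounded psi -> linearly_bounded (fun w => phi w + psi w).
Proof.
case=> mphi [C hC] [mpsi [C' hC']]; split; first exact: measurable_funD.
exists (C + C') => w w1; rewrite mulrDl (le_trans (ler_normD _ _))//.
by rewrite lerD ?hC ?hC'.
Qed.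

Lemma pareto_meanZ (c : R) (phi : R -> R) : linearly_bounded phi ->
  pareto_mean (fun w => c * phi w) = c * pareto_mean phi.
Proof.
move=> bphi; rewrite /pareto_mean -RintegralZl//; last exact: integrable_lb.
by apply: eq_Rintegral => w _; rewrite -mulrA.
Qed.

Lemma pareto_meanD (phi psi : R -> R) : linearly_bounded phi -> linearly_bounded psi ->
  pareto_mean (fun w => phi w + psi w) = pareto_mean phi + pareto_mean psi.
Proof.
move=> bphi bpsi; rewrite /pareto_mean -RintegralD//; try exact: integrable_lb.
by apply: eq_Rintegral => w _; rewrite mulrDl.
Qed.

Lemma pareto_meanB (phi psi : R -> R) : linearly_bounded phi -> linearly_bounded psi ->
  pareto_mean (fun w => phi w - psi w) = pareto_mean phi - pareto_mean psi.
Proof.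
move=> bphi bpsi; rewrite -mulN1r -pareto_meanZ// -pareto_meanD//.
  by apply: eq_Rintegral => w _; rewrite mulN1r.
exact: linearly_boundedZ.
Qed.

Lemma pareto_mean_le (phi psi : R -> R) : linearly_bounded phi -> linearly_bounded psi ->
  (forall w, 1 <= w -> phi w <= psi w) -> pareto_mean phi <= pareto_mean psi.
Proof.
move=> bphi bpsi le; apply: le_Rintegral => //; [exact: integrable_lb|exact: integrable_lb|].
move=> w /=; rewrite in_itv/= andbT => w1.
by rewrite ler_wpM2r ?le// mulr_ge0 ?powR_ge0 ?(ltW tau1).
Qed.

Lemma linearly_bounded_id : linearly_bounded id.
Proof. by split => //; exists 1 => w w1; rewrite mul1r ger0_norm// (le_trans _ w1). Qed.

End pareto_integral.

(** * Means of the Potts functions *)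

Section potts_pareto.
Context (R : realType) (a k B : R).
Hypotheses (a0 : 0 < a) (k3 : 3 <= k).
Notation m := ((a + 2 - 1) / a).
Notation ratio := (potts_ratio k B).

Definition log_mean (t : R) : R := pareto_mean a (fun w => potts_log k B (t * w)).
Definition weight_mean (t : R) : R :=
  pareto_mean a (fun w => w * potts_weight k B (t * w)).
(** The closed form of F_B(t) for t > 0. The leading factor a is (tau - 1)/E[W], since tau = a + 2
    and E[W] = (a + 1)/a. *)
Definition ratio_mean (t : R) : R := a * (t `^ a * power_tail a ratio t).

Let measurable_scale (f : R -> R) (t : R) : continuous f ->
  measurable_fun setT (fun w => f (t * w)).
Proof.
move=> cf; apply: continuous_measurable_fun => x.
by apply: continuous_comp; [exact: mulrl_continuous|exact: cf].
Qed.

Let lb_weight (t : R) : linearly_bounded (fun w => w * potts_weight k B (t * w)).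
Proof.
split.
  apply: measurable_funM => //; apply: measurable_scale => x.
  have H := is_derive_potts_den k B x.
  apply: cvgM; first exact: is_derive_continuous (is_derive_expR_shift B x).
  by apply: cvgV; [rewrite gt_eqF ?potts_den_gt0|exact: is_derive_continuous H].
exists 1 => w w1; have w0 : 0 <= w by exact: le_trans w1.
have /andP[h0 h1] := potts_weight01 B k3 (t * w).
by rewrite ger0_norm; [rewrite mul1r ler_piMr|exact: mulr_ge0].
Qed.

Let lb_log (t : R) : linearly_bounded (fun w => potts_log k B (t * w)).
Proof.
split.
  by apply: measurable_scale => x; exact: is_derive_continuous (is_derive_potts_log B k3 x).
exists (`|t| + (`|B| + ln k)) => w w1; have w0 : 0 <= w by exact: le_trans w1.
have /andP[h0 h1] := potts_log_le B k3 (t * w).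
rewrite ger0_norm// (le_trans h1)// normrM (ger0_norm w0) mulrDl lerD2l.
by rewrite ler_peMr// addr_ge0// ln_ge0//; have := k3; lra.
Qed.

Lemma log_mean_increment (x y : R) : x <= y ->
  (y - x) * weight_mean x <= log_mean y - log_mean x <= (y - x) * weight_mean y.
Proof.
move=> xy; rewrite -!pareto_meanZ// -pareto_meanB//.
have bb : linearly_bounded (fun w => potts_log k B (y * w) - potts_log k B (x * w)).
  have := linearly_boundedD (lb_log y) (linearly_boundedZ (-1) (lb_log x)).
  congr linearly_bounded; apply/funext => w; by rewrite mulN1r.
have conv w : 1 <= w -> x * w <= y * w.
  by move=> w1; rewrite ler_wpM2r// (le_trans _ w1).
apply/andP; split; apply: pareto_mean_le => //; try exact: linearly_boundedZ.
  move=> w /conv /(potts_log_convex B k3)/andP[+ _].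
  by rewrite -mulrBl -mulrA.
move=> w /conv /(potts_log_convex B k3)/andP[_ +].
by rewrite -mulrBl -mulrA.
Qed.

Lemma weight_mean_bounds (t : R) : 0 <= weight_mean t <= m.
Proof.
apply/andP; split.
  apply: Rintegral_ge0 => w /=; rewrite in_itv/= andbT => w1.
  have /andP[h0 h1] := potts_weight01 B k3 (t * w).
  have w0 : 0 <= w by exact: le_trans w1.
  have a0' := ltW a0.
  by rewrite mulr_ge0 ?(mulr_ge0 w0)// mulr_ge0 ?powR_ge0//; lra.
rewrite -pareto_mean_id//; apply: pareto_mean_le => //; first exact: linearly_bounded_id.
move=> w w1; have /andP[h0 h1] := potts_weight01 B k3 (t * w).
by rewrite ler_piMr// (le_trans _ w1).
Qed.

(** The slopes lie in [0, m], so the function is Lipschitz. Continuity is obtained at 0 as well,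
    where the maximization over a closed interval needs it. *)
Lemma continuous_log_mean : continuous log_mean.
Proof.
have m0 : 0 < m by rewrite divr_gt0//; have := a0; lra.
have lip x y : `|log_mean x - log_mean y| <= m * `|x - y|.
  wlog xy : x y / x <= y.
    move=> wl; have [|/ltW yx] := leP x y; first exact: wl.
    by rewrite distrC (distrC x); exact: wl.
  have /andP[h1 h2] := log_mean_increment xy.
  have /andP[s1 _] := weight_mean_bounds x; have /andP[_ s2] := weight_mean_bounds y.
  have d0 : 0 <= y - x by rewrite subr_ge0.
  rewrite distrC (distrC x) (ger0_norm d0) ger0_norm; last first.
    by apply: le_trans h1; rewrite mulr_ge0.
  by apply: (le_trans h2); rewrite mulrC ler_wpM2r.
move=> t; apply/cvgrPdist_lt => e e0; near=> z.
apply: (le_lt_trans (lip _ _)); rewrite mulrC -ltr_pdivlMr//.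
by near: z; apply: cvgr_dist_lt => //; rewrite divr_gt0.
Unshelve. all: by end_near. Qed.

Hypothesis B0 : 0 <= B.

Let r01 := potts_ratio01 k3 B0.
Let cr := @continuous_potts_ratio R k B k3.

Lemma ratio_mean_ode (t : R) : 0 < t ->
  is_derive t 1 ratio_mean (a * (ratio_mean t - ratio t) / t).
Proof.
move=> t0; apply: (@is_derive_eq _ _ _ _ _ _ _ _
  (is_deriveM (is_derive_cst a t 1) (is_derive_scaled a0 cr r01 t0))).
by rewrite /GRing.scale/= ?fctE /ratio_mean; field; rewrite gt_eqF.
Qed.

Lemma ratio_mean01 (t : R) : 0 < t -> 0 <= ratio_mean t <= 1.
Proof.
move=> t0; apply/andP; split.
  by rewrite mulr_ge0 ?mulr_ge0 ?powR_ge0 ?(ltW a0) ?power_tail_ge0.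
by rewrite /ratio_mean -ler_pdivlMl// mulr1 power_tail_le.
Qed.

Lemma weight_meanE (t : R) : 0 < t ->
  weight_mean t = m / k + m * (k - 1) / k * ratio_mean t.
Proof.
move=> t0.
have lbr : linearly_bounded (fun w => w * ratio (t * w)).
  have k0 : k - 1 != 0 by rewrite gt_eqF//; have := k3; lra.
  have kn0 : k != 0 by rewrite gt_eqF//; have := k3; lra.
  have := linearly_boundedD (linearly_boundedZ (k / (k - 1)) (lb_weight t))
    (linearly_boundedZ (- (k - 1)^-1) (linearly_bounded_id R)).
  congr linearly_bounded; apply/funext => w; rewrite potts_weightE//.
  by field; rewrite k0.
have lbi := linearly_boundedZ k^-1 (linearly_bounded_id R).
have lbr' := linearly_boundedZ ((k - 1) / k) lbr.
transitivity (pareto_mean a (fun w => k^-1 * w + (k - 1) / k * (w * ratio (t * w)))).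
  by apply: eq_Rintegral => w _; rewrite potts_weightE// mulrDr [w / k]mulrC
    [w * (_ * _)]mulrCA.
rewrite pareto_meanD// !pareto_meanZ//; last exact: linearly_bounded_id.
rewrite pareto_mean_id// pareto_mean_scale// /ratio_mean.
have a0' : a != 0 by rewrite gt_eqF.
have kn0 : k != 0 by rewrite gt_eqF//; have := k3; lra.
by field; rewrite ?a0' ?kn0.
Qed.

(** The slope [weight_mean] is affine in [ratio_mean], whose continuity on (0, +oo) comes from its
    differential equation. *)
Lemma is_derive_log_mean (t : R) : 0 < t ->
  is_derive t 1 log_mean (m / k + m * (k - 1) / k * ratio_mean t).
Proof.
move=> t0; rewrite -weight_meanE//.
apply: is_derive_of_increments; first exact: log_mean_increment.
rewrite /prop_for /continuous_at weight_meanE//.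
have : (fun z => m / k + m * (k - 1) / k * ratio_mean z) z @[z --> t] -->
    m / k + m * (k - 1) / k * ratio_mean t.
  apply: cvgD; first exact: cvg_cst.
  by apply: cvgM; [exact: cvg_cst|exact: is_derive_continuous (ratio_mean_ode t0)].
apply: cvg_trans; apply: near_eq_cvg; near=> z.
by rewrite weight_meanE//; near: z; exact: lt_nbhsr.
Unshelve. all: by end_near. Qed.

End potts_pareto.

(** * The phase transition *)

Section ratio_ode.
Context (R : realType) (a k B : R) (F : R -> R).
Hypotheses (a2 : 2 <= a) (k3 : 3 <= k) (B0 : 0 <= B).
Hypothesis kB : 1 < expR (- B) * (k - 1).
Hypothesis FE : forall t : R, 0 < t -> F t = ratio_mean a k B t.
Notation ratio := (potts_ratio k B).

Let a0 : 0 < a. Proof. exact: lt_le_trans a2. Qed.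

Let F_ode (t : R) : 0 < t -> is_derive t 1 F (a * (F t - ratio t) / t).
Proof.
move=> t0; rewrite FE//; apply: near_eq_is_derive (ratio_mean_ode a0 k3 B0 t0).
by near=> x; rewrite FE//; near: x; exact: lt_nbhsr.
Unshelve. all: by end_near. Qed.

Let F01 (t : R) : 0 < t -> 0 <= F t <= 1.
Proof. by move=> t0; rewrite FE// ratio_mean01. Qed.

Let r01 (t : R) : 0 < t -> 0 < ratio t < 1.
Proof. by move=> t0; rewrite potts_ratio_gt0// potts_ratio_lt1. Qed.

Let r2p (t : R) : 0 < t < ln (k - 1) - B -> 0 < potts_ratio2 k B t.
Proof. by case/andP=> _; exact: potts_ratio2_gt0. Qed.

Let u00 := potts_inflection_gt0 k3 kB.

Let half0 : 0 < (ln (k - 1) - B) / 2. Proof. by rewrite divr_gt0. Qed.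

Lemma ratio_first_pos_then_neg :
  twice_derivable_pos F /\ first_pos_then_neg ((F^`(2))%classic).
Proof.
have [m m0 r2m] := potts_ratio2_ge k3 B0 kB.
exact: (ode_first_pos_then_neg a2 u00 m0 half0 F_ode (is_derive_potts_ratio B k3)
  (is_derive_potts_ratio1 B k3) F01 r01 (potts_ratio1_le1 k3 B0) r2m r2p
  (@potts_ratio2_lt0 R k B k3)).
Qed.

Lemma ratio_in01 (t : R) : 0 < t -> 0 < F t < 1.
Proof.
by move=> t0; rewrite (ode_gt0 a2 F_ode F01 r01 t0) (ode_lt1 a2 F_ode F01 r01 t0).
Qed.

Lemma ratio_continuous (t : R) : 0 < t -> {for t, continuous F}.
Proof. by move=> t0; exact: is_derive_continuous (F_ode t0). Qed.

Lemma ratio_excess_gt0 : B = 0 ->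
  exists2 t0, 0 < t0 & 0 < (a - 1) * F t0 - a * ratio t0.
Proof.
move=> BE; have [m m0 r2m] := potts_ratio2_ge k3 B0 kB.
apply: (ode_excess_gt0 a2 u00 m0 half0 F_ode (is_derive_potts_ratio B k3)
  (is_derive_potts_ratio1 B k3) F01 r01 (potts_ratio1_le1 k3 B0) r2m r2p
  (@potts_ratio2_lt0 R k B k3)).
by rewrite /potts_ratio BE addr0 expR0 subrr mul0r.
Qed.

Lemma ratio_zones (t0 : R) : 0 < t0 -> 0 < (a - 1) * F t0 - a * ratio t0 ->
  exists t1 t2 : R, [/\ 0 <= t1, t1 < t2,
    forall x y, 0 < x -> x < y -> y <= t1 -> F y / y < F x / x,
    forall x y, 0 < x -> t1 <= x -> x < y -> y <= t2 -> F x / x < F y / y &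
    forall x y, t2 <= x -> x < y -> F y / y < F x / x].
Proof.
have [m m0 r2m] := potts_ratio2_ge k3 B0 kB.
exact: (ode_ratio_zones a2 u00 m0 half0 F_ode (is_derive_potts_ratio B k3)
  (is_derive_potts_ratio1 B k3) F01 r01 (potts_ratio1_le1 k3 B0) r2m r2p
  (@potts_ratio2_lt0 R k B k3) (@potts_ratio_cvg1 R k B k3)).
Qed.

End ratio_ode.

(* [ratio_mean] is nondecreasing in the field, so it suffices to perturb the
   explicit term of [ratio_excess_gt0]. *)
Lemma ratio_excess_gt0_field (R : realType) (a k : R) : 2 <= a -> 3 <= k ->
  exists2 delta : R, 0 < delta & exists2 t0 : R, 0 < t0 &
    forall B : R, 0 <= B -> B <= delta -> 1 < expR (- B) * (k - 1) /\
      0 < (a - 1) * ratio_mean a k B t0 - a * potts_ratio k B t0.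
Proof.
move=> a2 k3; have a0 : 0 < a by exact: lt_le_trans a2.
have k0B : 1 < expR (- 0) * (k - 1) by rewrite oppr0 expR0 mul1r; lra.
have [t0 t00 ex] := ratio_excess_gt0 a2 k3 (lexx 0) k0B (fun t _ => erefl) erefl.
have c1 : (fun B : R => expR (- B) * (k - 1)) B @[B --> 0] --> expR (- 0) * (k - 1).
  apply: cvgM; last exact: cvg_cst.
  apply: (@continuous_comp _ _ _ (fun B : R => - B) (@expR R)).
    by apply: cvgN; exact: cvg_id.
  exact: continuous_expR.
(* The field only shifts the argument of [potts_ratio], so continuity in B reduces to continuity in
   x; [ratio_mean] is kept at field 0. *)
have c2 :
    (a - 1) * ratio_mean a k 0 t0 - a * potts_ratio k 0 (t0 + B) @[B --> (0 : R)] -->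
    (a - 1) * ratio_mean a k 0 t0 - a * potts_ratio k 0 (t0 + 0).
  apply: cvgB; first exact: cvg_cst.
  apply: cvgM; first exact: cvg_cst.
  apply: (@continuous_comp _ _ _ (fun B => t0 + B) (potts_ratio k 0)).
    by apply: cvgD; [exact: cvg_cst|exact: cvg_id].
  exact: continuous_potts_ratio.
have ex' : 0 < (a - 1) * ratio_mean a k 0 t0 - a * potts_ratio k 0 (t0 + 0) by rewrite addr0.
have n1 : \forall B \near (0 : R), 1 < expR (- B) * (k - 1) by exact: cvgr_gt c1 _ k0B.
have n2 : \forall B \near (0 : R),
    0 < (a - 1) * ratio_mean a k 0 t0 - a * potts_ratio k 0 (t0 + B).
  exact: cvgr_gt c2 _ ex'.
have n12 : \forall B \near (0 : R), 1 < expR (- B) * (k - 1) /\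
    0 < (a - 1) * ratio_mean a k 0 t0 - a * potts_ratio k 0 (t0 + B).
  by near do split.
move/nbhs_ballP: n12 => [e /= e0 eB].
(* Half the radius keeps the closed range 0 <= B <= delta inside the open ball. *)
exists (e / 2); first by rewrite divr_gt0.
exists t0 => // B B0 Be.
have [|h1 h2] := eB B; first by rewrite /ball/= sub0r normrN ger0_norm//; lra.
split => //; apply: lt_le_trans h2 _.
have -> : potts_ratio k 0 (t0 + B) = potts_ratio k B t0 by rewrite /potts_ratio addr0.
rewrite lerD2r; apply: ler_wpM2l; first by lra.
apply: ler_wpM2l; first exact: ltW.
apply: ler_wpM2l; first exact: powR_ge0.
apply: le_power_tail => //; try exact: continuous_potts_ratio.
- exact: potts_ratio01.
- exact: potts_ratio01.
- move=> x x0; have -> : potts_ratio k B x = potts_ratio k 0 (x + B).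
    by rewrite /potts_ratio addr0.
  by apply: potts_ratio_le => //; rewrite lerDl.
Unshelve. all: by end_near. Qed.

(** * From the pressure to the penalized problem *)

Section potts_model.
Context (R : realType) (d : measure_display) (T : measurableType d).
Context (P : probability T R) (W : {RV P >-> R}) (q : nat) (a : R).
Hypotheses (a2 : 2 <= a) (q3 : (3 <= q)%N) (hW : has_density W (pareto_pdf (a + 2))).

Let k : R := q%:R.
Let k3 : 3 <= k. Proof. by rewrite ler_nat. Qed.
Let a0 : 0 < a. Proof. exact: lt_le_trans a2. Qed.
Let m : R := (a + 2 - 1) / a.
Let m0 : 0 < m. Proof. by rewrite divr_gt0//; have := a0; lra. Qed.

Let mean_W (phi : R -> R) : measurable_fun setT phi ->
  (forall w, 1 <= w -> 0 <= phi w) -> fine ('E_P[phi \o W])%E = pareto_mean a phi.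
Proof.
by move=> mphi phi0; rewrite (expectation_pareto _ hW)//; have := a0; lra.
Qed.

Lemma meanW_pareto : meanW W = m.
Proof.
rewrite /meanW /m -pareto_mean_id// -mean_W// => w w1; exact: le_trans w1.
Qed.

Lemma FB_ratio_mean (B t : R) : 0 <= B -> 0 < t -> FB W q B t = ratio_mean a k B t.
Proof.
move=> B0 t0; have cr := @continuous_potts_ratio R k B k3.
have r01 := potts_ratio01 k3 B0.
have mr : measurable_fun setT (fun w : R => w * potts_ratio k B (t * w)).
  apply: measurable_funM => //; apply: continuous_measurable_fun => x.
  by apply: continuous_comp; [exact: mulrl_continuous|exact: cr].
have r_ge0 w : 1 <= w -> 0 <= potts_ratio k B (t * w) <= 1.
  by move=> w1; apply: r01; rewrite mulr_ge0 ?(ltW t0)// (le_trans _ w1).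
have lb : linearly_bounded (fun w => w * potts_ratio k B (t * w)).
  split => //; exists 1 => w w1; have w0 : 0 <= w by exact: le_trans w1.
  have /andP[h0 h1] := r_ge0 w w1.
  by rewrite ger0_norm; [rewrite mul1r ler_piMr|exact: mulr_ge0].
rewrite /FB meanW_pareto.
have -> : (fun x => W x / m * ((expR (t * W x + B) - 1) / (expR (t * W x + B) + q%:R - 1))) =
    (fun w => m^-1 * (w * potts_ratio k B (t * w))) \o W.
  by apply/funext => x /=; rewrite [RHS]mulrA [m^-1 * _]mulrC.
rewrite mean_W; last 2 first.
- exact: measurable_funM.
- move=> w w1; have /andP[h0 _] := r_ge0 w w1.
  by rewrite mulr_ge0 ?invr_ge0 ?(ltW m0)// mulr_ge0// (le_trans _ w1).
rewrite pareto_meanZ// pareto_mean_scale// /ratio_mean /m.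
have a0' := a0; field.
by rewrite gt_eqF//= gt_eqF//; lra.
Qed.

(** [log_mean] normalized so that its derivative is exactly F_B: the linear term removes the
    constant part of the slope, and the division removes the factor in front of [ratio_mean]. *)
Let Phi (B t : R) : R := (log_mean a k B t - m / k * t) / (m * (k - 1) / k).

(** With t = b s, the term of the pressure linear in s is absorbed into [Phi], the quadratic one
    becomes t^2/(2b), and the constant one is left over. *)
Lemma pressure_penalized (beta B s : R) : 0 < beta -> 0 <= B ->
  pressure W q beta B s = m * (k - 1) / k *
    penalized (Phi B) (expR beta - 1) ((expR beta - 1) * s) + (expR beta - 1) * m / (2 * k).
Proof.
move=> beta0 B0; rewrite /pressure meanW_pareto.
set b := expR beta - 1.
have b0 : b != 0 by rewrite gt_eqF// subr_gt0 -expR0 ltr_expR.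
have -> : (fun x => ln (expR (b * W x * s + B) + q%:R - 1)) =
    (fun w => potts_log k B (b * s * w)) \o W.
  by apply/funext => x /=; rewrite [b * s * _]mulrAC.
rewrite mean_W; last 2 first.
- apply: continuous_measurable_fun => x.
  apply: continuous_comp; first exact: mulrl_continuous.
  exact: is_derive_continuous (is_derive_potts_log B k3 _).
- by move=> w _; have /andP[] := potts_log_le B k3 (b * s * w).
rewrite -/(log_mean a k B (b * s)) /penalized /Phi -/k.
have m0' := m0; have k3' := k3.
have mn0 : m != 0 by rewrite gt_eqF.
have k1 : k - 1 != 0 by rewrite gt_eqF//; lra.
have k0 : k != 0 by rewrite gt_eqF//; lra.
by field; rewrite ?b0 ?mn0 ?k1 ?k0.
Qed.

Lemma pressure_maximizersE (beta B s : R) : 0 < beta -> 0 <= B ->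
  pressure_maximizers W q beta B s <->
  penalized_argmax (Phi B) (expR beta - 1) ((expR beta - 1) * s).
Proof.
move=> beta0 B0; set b := expR beta - 1.
have b0 : 0 < b by rewrite subr_gt0 -expR0 ltr_expR.
have K0 : 0 < m * (k - 1) / k.
  have k0 : 0 < k by exact: lt_le_trans k3.
  rewrite divr_gt0// mulr_gt0 ?m0// subr_gt0.
  by apply: lt_le_trans k3; rewrite ltr1n.
have rng u : (0 <= b * u <= b) = (0 <= u <= 1).
  by rewrite pmulr_rge0// -[in X in _ && (_ <= X)](mulr1 b) ler_pM2l.
have pE u : (pressure W q beta B u <= pressure W q beta B s) =
    (penalized (Phi B) b (b * u) <= penalized (Phi B) b (b * s)).
  by rewrite !pressure_penalized// lerD2r ler_pM2l.
rewrite /pressure_maximizers/= /penalized_argmax/= rng; split=> -[s01 smax]; split => //.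
  move=> v; have -> : v = b * (v / b) by rewrite mulrC divfK// gt_eqF.
  by rewrite rng -pE; exact: smax.
by move=> u; rewrite -rng pE; exact: smax.
Qed.

Lemma continuous_Phi (B : R) : continuous (Phi B).
Proof.
move=> t; apply: cvgM; last exact: cvg_cst.
apply: cvgB; first exact: continuous_log_mean.
by apply: cvgM; [exact: cvg_cst|exact: cvg_id].
Qed.

Lemma is_derive_Phi (B t : R) : 0 <= B -> 0 < t -> is_derive t 1 (Phi B) (FB W q B t).
Proof.
move=> B0 t0; rewrite FB_ratio_mean//.
have k3' := k3; have m0' := m0.
apply: (@is_derive_eq _ _ _ _ _ _ _ _ (is_deriveM
  (is_deriveB (is_derive_log_mean a0 k3 B0 t0)
    (is_deriveM (is_derive_cst (m / k) t 1) (is_derive_id t 1)))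
  (is_derive_cst (m * (k - 1) / k)^-1 t 1))).
rewrite /GRing.scale/= ?fctE -/m.
have mn0 : m != 0 by rewrite gt_eqF.
have k1 : k - 1 != 0 by rewrite gt_eqF//; lra.
have k0 : k != 0 by rewrite gt_eqF//; lra.
by field; rewrite ?mn0 ?k1 ?k0.
Qed.

Lemma potts_transition (B t1 t2 : R) : 0 <= B -> 0 <= t1 -> t1 < t2 ->
  (forall t, 0 < t -> {for t, continuous (FB W q B)}) ->
  (forall t, 0 < t -> 0 < FB W q B t < 1) ->
  (forall x y, 0 < x -> x < y -> y <= t1 -> FB W q B y / y < FB W q B x / x) ->
  (forall x y, 0 < x -> t1 <= x -> x < y -> y <= t2 -> FB W q B x / x < FB W q B y / y) ->
  (forall x y, t2 <= x -> x < y -> FB W q B y / y < FB W q B x / x) ->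
  first_order_transition W q B.
Proof.
move=> B0 t10 t12 cF F01 dec1 inc12 dec2.
have cPhi := @continuous_Phi B.
have [bc [bc0 uniq zone1 zone2]] := penalized_argmax_transition t10 t12 cPhi
  (fun t => is_derive_Phi B0) cF (fun t t0 => proj1 (andP (F01 t t0)))
  (fun t t0 => proj2 (andP (F01 t t0))) dec1 inc12 dec2.
pose betac := ln (1 + bc).
have bcE : expR betac - 1 = bc by rewrite lnK ?posrE; [rewrite addrAC subrr add0r|lra].
have betac0 : 0 < betac by rewrite -ltr_expR expR0; move: bcE bc0; lra.
pose b (beta : R) := expR beta - 1.
have b_gt0 beta : 0 < beta -> 0 < b beta.
  by move=> h; rewrite subr_gt0 -expR0 ltr_expR.
have b_lt x y : (b x < b y) = (x < y) by rewrite ltrD2r ltr_expR.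
(* The maximizer in the variable t = b s. Monotonicity is available for [theta], not directly for
   [sstar]; it yields the one-sided limits, which are divided by b afterwards. *)
pose theta beta := b beta * sstar W q B beta.
(* A maximizer exists for every beta > 0, so [sstar] is a true maximizer and never merely the
   default value 0. *)
have theta_max beta : 0 < beta -> penalized_argmax (Phi B) (b beta) (theta beta).
  move=> h; apply/pressure_maximizersE => //; apply: xgetPex.
  have [t tm] := penalized_argmax_neq0 cPhi (b_gt0 _ h).
  exists (t / b beta); apply/pressure_maximizersE => //.
  by rewrite mulrC divfK// gt_eqF// b_gt0.
have theta_mono x y : 0 < x -> x <= y -> theta x <= theta y.
  move=> x0; rewrite le_eqVlt => /predU1P[->//|xy].
  have y0 := lt_trans x0 xy.
  apply: penalized_argmax_mono (theta_max x x0) (theta_max y y0); rewrite ?b_lt//.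
  exact: b_gt0.
have theta1 x : 0 < x -> x < betac -> theta x <= t1.
  by move=> x0 xc; apply: (zone1 (b x)) (theta_max x x0); rewrite ?b_gt0// -bcE b_lt.
have theta2 x : betac < x -> t2 <= theta x.
  move=> xc; apply: (zone2 (b x)) (theta_max x (lt_trans betac0 xc)).
  by rewrite -bcE b_lt.
exists betac; split => //; split.
  move=> beta beta0 betaN; have bb : b beta != bc.
    rewrite -bcE; apply: contra betaN => /eqP E.
    by have [h|h|//] := ltgtP beta betac; move: h; rewrite -b_lt E ltxx.
  have [t [tm tu]] := uniq _ (b_gt0 _ beta0) bb.
  have bn0 : b beta != 0 by rewrite gt_eqF ?b_gt0.
  exists (t / b beta); split.
    by apply/pressure_maximizersE => //; rewrite mulrC divfK.
  move=> s /pressure_maximizersE => /(_ beta0 B0)/tu ->.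
  by rewrite mulrC mulKf.
have cb : b beta @[beta --> betac] --> bc.
  by rewrite -bcE; apply: cvgB; [exact: continuous_expR|exact: cvg_cst].
have left_cvg : cvg (theta x @[x --> betac^'-]).
  apply: nondecreasing_at_left_is_cvgr; near=> x.
    have x0 : 0 < x by near: x; exact: nbhs_left_gt.
    move=> y z; rewrite in_itv/= => /andP[xy _] _; exact: theta_mono (lt_trans x0 xy).
  have x0 : 0 < x by near: x; exact: nbhs_left_gt.
  exists t1 => z [y /=]; rewrite in_itv/= => /andP[xy yc] <-.
  by apply: theta1 => //; exact: lt_trans xy.
have right_cvg : cvg (theta x @[x --> betac^'+]).
  apply: nondecreasing_at_right_is_cvgr; near=> x.
    move=> y z; rewrite in_itv/= => /andP[xy _] _; exact: theta_mono (lt_trans betac0 xy).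
  exists t2 => z [y /=]; rewrite in_itv/= => /andP[xy _] <-.
  exact: theta2.
have liml : lim (theta x @[x --> betac^'-]) <= t1.
  apply: limr_le => //; near=> x; apply: theta1; last by near: x; exact: nbhs_left_lt.
  by near: x; exact: nbhs_left_gt.
have limr : t2 <= lim (theta x @[x --> betac^'+]).
  by apply: limr_ge => //; near=> x; apply: theta2; near: x; exact: nbhs_right_gt.
have sE x : 0 < x -> theta x / b x = sstar W q B x.
  by move=> x0; rewrite /theta mulrC mulKf// gt_eqF ?b_gt0.
have bcn0 : bc != 0 by rewrite gt_eqF.
(* Both limits are divided by the same [bc], so the gap between [t1] and [t2] survives as the jump
   of [sstar]. *)
exists (lim (theta x @[x --> betac^'-]) / bc), (lim (theta x @[x --> betac^'+]) / bc).
split; last split.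
- have : theta x / b x @[x --> betac^'-] --> lim (theta x @[x --> betac^'-]) / bc.
    by apply: cvgM => //; apply: cvgV => //; exact: cvg_at_left_filter.
  apply: cvg_trans; apply: near_eq_cvg; near=> x.
  by rewrite sE//; near: x; exact: nbhs_left_gt.
- have : theta x / b x @[x --> betac^'+] --> lim (theta x @[x --> betac^'+]) / bc.
    by apply: cvgM => //; apply: cvgV => //; exact: cvg_at_right_filter.
  apply: cvg_trans; apply: near_eq_cvg; near=> x.
  by rewrite sE// (lt_trans betac0)//; near: x; exact: nbhs_right_gt.
- by rewrite ltr_pM2r ?invr_gt0// (le_lt_trans liml)// (lt_le_trans t12).
Unshelve. all: by end_near. Qed.

End potts_model.

Theorem theorem1p21 (R : realType) (d : measure_display) (T : measurableType d)
    (P : probability T R) (W : {RV P >-> R}) (q : nat) (tau : R)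
    (hq : (3 <= q)%N) (htau : 4 <= tau)
    (hW : has_density W (pareto_pdf tau)) :
  (forall B : R, 0 <= B -> 1 < expR (- B) * (q%:R - 1) ->
     twice_derivable_pos (FB W q B) /\
     first_pos_then_neg (((FB W q B)^`(2))%classic)) /\
  (exists delta : R, 0 < delta /\
     forall B : R, 0 <= B -> B <= delta -> first_order_transition W q B).
Proof.
have tauE : tau = (tau - 2) + 2 by rewrite subrK.
rewrite tauE in hW; have a2 : 2 <= tau - 2 by lra.
move: (tau - 2) a2 hW => a a2 {tauE htau}hW.
have k3 : 3 <= q%:R :> R by rewrite ler_nat.
have FE B := @FB_ratio_mean R d T P W q a a2 hq hW B.
split=> [B B0 kB|]; first exact: (ratio_first_pos_then_neg a2 k3 B0 kB (fun t => @FE B t B0)).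
(* A single [t0] works for all fields up to [delta]; the positive excess there creates the
   increasing zone of F(t)/t. *)
have [delta delta0 [t0 t00 ex]] := ratio_excess_gt0_field a2 k3.
exists delta; split => // B B0 Bd; have [kB exB] := ex B B0 Bd.
have FEB t : 0 < t -> FB W q B t = ratio_mean a q%:R B t by exact: FE.
rewrite -FEB// in exB.
have [t1 [t2 [t10 t12 dec1 inc12 dec2]]] := ratio_zones a2 k3 B0 kB FEB t00 exB.
apply: (potts_transition a2 hq hW B0 t10 t12) => //.
  exact: ratio_continuous FEB.
exact: ratio_in01 FEB.
Qed.
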